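(* Assume $u_0$ and the initial height functions $\sigma_n(\cdot,0)$ satisfy the hypotheses below, fix a positive integer $h$, a closed set $B\subseteq\mathbb R^d$ and $t>0$. Suppose that on the same probability space there are initial height functions $\zeta_n(\cdot,0)\in\Sigma$ with $\sigma_n(y,0)\le\zeta_n(y,0)\le\sigma_n(y,0)+h$ for all $n,y$, and that $\sigma_n(\cdot,\cdot)$ and $\zeta_n(\cdot,\cdot)$ are both constructed by the variational formula with the same Poisson point process (so that $\sigma_n(x,s)\le\zeta_n(x,s)\le\sigma_n(x,s)+h$ for all $n,x,s$). Let $A_n(s)=\{x\in\mathbb R^d:\zeta_n(x,s)=\sigma_n(x,s)+h\}$ and assume that almost surely, for every compact $K\subseteq\mathbb R^d$ and $\varepsilon>0$, $B^{(-\varepsilon)}\cap K\subseteq (n^{-1}A_n(0))\cap K\subseteq B^{(\varepsilon)}\cap K$ for all large enough $n$. Then: (1) If $W(B,t)=\emptyset$, then almost surely, for every compact $K$, $A_n(nt)\cap nK=\emptyset$ for all large enough $n$. (2) If $W(B,t)\neq\emptyset$, then almost surely, for every compact $K$ and $\varepsilon>0$, $\mathrm{bd}\{n^{-1}A_n(nt)\}\cap K\subseteq X(B,t)^{(\varepsilon)}\cap K$ for all large enough $n$. (3) If in addition no point of $W(\overline{B^c},t)$ is an interior point of $W(B,t)$, then almost surely, for every compact $K$ and $\varepsilon>0$, $W(B,t)^{(-\varepsilon)}\cap K\subseteq \{n^{-1}A_n(nt)\}\cap K\subseteq W(B,t)^{(\varepsilon)}\cap K$ for all large enough $n$.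
   Context: Order conventions: for $x,y\in\mathbb R^\nu$ write $x\le y$ if $x_i\le y_i$ for all $i$, and $x<y$ if $x_i<y_i$ for all $i$; $\mathbf 1=(1,\dots,1)$; $|x|_\infty=\max_i|x_i|$. Fix $d\ge2$. $\mathbb Z^*=\mathbb Z\cup\{\pm\infty\}$. The state space $\Sigma$ is the set of functions $\sigma:\mathbb R^d\to\mathbb Z^*$ such that (i) $x\le y$ implies $\sigma(x)\le\sigma(y)$; (ii) for every cube $[-q\mathbf 1,q\mathbf 1]$ there are finite partitions $-q=s_i^0<\dots<s_i^{m_i}=q$ of each coordinate axis such that $\sigma$ is constant on each rectangle $\prod_{i}[s_i^{k_i},s_i^{k_i+1})$; (iii) for every $b\in\mathbb R^d$, $\lim_{M\to\infty}\sup\{|y|_\infty^{-d/(d+1)}\sigma(y): y\le b,\ |y|_\infty\ge M\}=-\infty$. A rate-one Poisson point process on $\mathbb R^d\times(0,\infty)$ is given; for $y\le x$ and $t>0$, $\mathbf H((y,0),(x,t))$ is the maximal number of Poisson points on a strictly increasing chain (coordinatewise order in $\mathbb R^{d+1}$) in $\{(\eta,s):y<\eta\le x,0<s\le t\}$. Processes are defined from initial states by $\sigma(x,t)=\sup_{y\le x}\{\sigma(y,0)+\mathbf H((y,0),(x,t))\}$. Hypotheses on $u_0$ and $\sigma_n$: $u_0:\mathbb R^d\to\mathbb R$ is nondecreasing, locally Lipschitz, and for every $b$, $\lim_{M\to\infty}\sup\{|y|_\infty^{-d/(d+1)}u_0(y):y\le b,|y|_\infty\ge M\}=-\infty$; $\sigma_n(\cdot,0)$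 are random elements of $\Sigma$ with $n^{-1}\sigma_n(ny,0)\to u_0(y)$ a.s. for each $y$, and for every $b\in\mathbb R^d$, $C>0$, a.s. there are finite $M,N$ with $\sigma_n(ny,0)\le -Cn|y|_\infty^{d/(d+1)}$ whenever $n\ge N$, $y\le b$, $|y|_\infty\ge M$. $c_{d+1}$ is the a.s. limit of $n^{-1}\times$(maximal increasing chain length of a rate-one Poisson process in $(0,n\mathbf 1]\subseteq\mathbb R^{d+1}$); $g(x)=c_{d+1}(x_1\cdots x_d)^{1/(d+1)}$ for $x\ge0$, $g=-\infty$ otherwise; $u(x,t)=\sup_{y\le x}\{u_0(y)+tg((x-y)/t)\}$ for $t>0$. For $y\in\mathbb R^d$: $W(y,t)=\{x\in\mathbb R^d: x\ge y,\ u(x,t)=u_0(y)+tg((x-y)/t)\}$; for $B\subseteq\mathbb R^d$, $W(B,t)=\bigcup_{y\in B}W(y,t)$; for closed $B$, $X(B,t)=W(B,t)\cap W(\overline{B^c},t)$. For a set $B$ and $\varepsilon>0$: $B^{(\varepsilon)}=\{x: d(x,y)<\varepsilon\text{ for some }y\in B\}$ and $B^{(-\varepsilon)}=\{x\in B: d(x,y)\ge\varepsilon\text{ for all }y\notin B\}$ (Euclidean distance). $\mathrm{bd}$ denotes the topological boundary $\overline{A}\cap\overline{A^c}$. *)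

(* Defs.v *)
From HB Require Import structures.
From mathcomp Require Import all_boot all_order all_algebra.
From mathcomp Require Import all_classical all_reals all_analysis.
Set Implicit Arguments. Unset Strict Implicit. Unset Printing Implicit Defensive.
Import Order.TTheory GRing.Theory Num.Theory.
Import numFieldNormedType.Exports.
Local Open Scope classical_set_scope.
Local Open Scope ring_scope.

Section Defs.
Variables (R : realType) (d : nat).

(* points of R^d are row vectors; points of R^{d+1} are pairs (space, time) *)
Notation V := 'rV[R]_d.
Definition coord (x : V) (i : 'I_d) : R := x ord0 i.

Definition vle (x y : V) : Prop := forall i, coord x i <= coord y i.
Definition vlt (x y : V) : Prop := forall i, coord x i < coord y i.
Definition supnorm (x : V) : R := \big[Num.max/0]_(i < d) `|coord x i|.
Definition edist (x y : V) : R := Num.sqrt (\sum_(i < d) (coord x i - coord y i) ^+ 2).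
Definition onev : V := const_mx 1.

Definition nbhd_plus (B : set V) (e : R) : set V :=
  [set x | exists y, B y /\ edist x y < e].
Definition nbhd_minus (B : set V) (e : R) : set V :=
  [set x | B x /\ forall y, ~ B y -> e <= edist x y].
Definition bd (A : set V) : set V := closure A `&` closure (~` A).
Definition invscale (n : nat) (A : set V) : set V := [set x | A (n%:R *: x)].
Definition scale (n : nat) (K : set V) : set V := [set n%:R *: k | k in K].

Definition expo : R := d%:R / (d.+1)%:R.

Definition in_Sigma (s : V -> \bar R) : Prop :=
  (forall x, s x = +oo%E \/ s x = -oo%E \/ exists z : int, s x = (z%:~R)%:E) /\
  (forall x y, vle x y -> (s x <= s y)%E) /\
  (forall q : R, 0 < q -> exists (m : 'I_d -> nat) (sp : 'I_d -> nat -> R),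
      (forall i, sp i 0%N = - q /\ sp i (m i) = q /\
                 forall k, (k < m i)%N -> sp i k < sp i k.+1) /\
      forall k : 'I_d -> nat, (forall i, (k i < m i)%N) ->
      forall x y : V,
        (forall i, sp i (k i) <= coord x i < sp i (k i).+1) ->
        (forall i, sp i (k i) <= coord y i < sp i (k i).+1) ->
        s x = s y) /\
  (forall b : V, forall C : R, exists M : R, forall y, vle y b -> M <= supnorm y ->
      ((supnorm y `^ (- expo))%:E * s y <= (- C)%:E)%E).

Definition box (a b : V * R) : set (V * R) :=
  [set p | (vlt a.1 p.1 /\ vle p.1 b.1) /\ a.2 < p.2 <= b.2].
Definition vol (a b : V * R) : R :=
  (\prod_(i < d) (coord b.1 i - coord a.1 i)) * (b.2 - a.2).

(* rate-one Poisson point process on R^d x (0,oo), given as a random set of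
   points; characterized by its finite-dimensional distributions on
   finite families of pairwise disjoint boxes (independent Poisson counts with
   means equal to the volumes). *)
Definition rate_one_poisson (dm : measure_display) (Om : measurableType dm)
    (P : probability Om R) (pts : Om -> set (V * R)) : Prop :=
  (forall w, pts w `<=` [set p | 0 < p.2]) /\
  forall (k : nat) (a b : 'I_k -> V * R) (m : 'I_k -> nat),
    (forall i, vlt (a i).1 (b i).1 /\ 0 <= (a i).2 < (b i).2) ->
    (forall i j, i != j -> box (a i) (b i) `&` box (a j) (b j) = set0) ->
    measurable [set w | forall i, card_eq (pts w `&` box (a i) (b i)) `I_(m i)] /\
    P [set w | forall i, card_eq (pts w `&` box (a i) (b i)) `I_(m i)] =
      (\prod_(i < k) (expR (- vol (a i) (b i)) * vol (a i) (b i) ^+ m i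
                       / (m i)`!%:R))%:E.

Definition in_region (y x : V) (t : R) (p : V * R) : Prop :=
  (vlt y p.1 /\ vle p.1 x) /\ 0 < p.2 <= t.
Definition plt (p q : V * R) : Prop := vlt p.1 q.1 /\ p.2 < q.2.
Definition Hlen (pts : set (V * R)) (y x : V) (t : R) : \bar R :=
  ereal_sup [set (k%:R)%:E | k in [set k : nat | exists f : nat -> V * R,
     (forall i, (i < k)%N -> pts (f i) /\ in_region y x t (f i)) /\
     (forall i, (i.+1 < k)%N -> plt (f i) (f i.+1))]].

Definition evol (pts : set (V * R)) (s0 : V -> \bar R) (x : V) (t : R) : \bar R :=
  ereal_sup [set (s0 y + Hlen pts y x t)%E | y in [set y | vle y x]].

Definition gfun (c : R) (x : V) : \bar R :=
  if `[< vle 0 x >] then (c * powR (\prod_(i < d) coord x i) (d.+1%:R)^-1)%:E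
  else -oo%E.
Definition ufun (c : R) (u0 : V -> R) (x : V) (t : R) : \bar R :=
  ereal_sup [set ((u0 y)%:E + t%:E * gfun c (t^-1 *: (x - y)))%E
              | y in [set y | vle y x]].

Definition Wpt (c : R) (u0 : V -> R) (y : V) (t : R) : set V :=
  [set x | vle y x /\ ufun c u0 x t = ((u0 y)%:E + t%:E * gfun c (t^-1 *: (x - y)))%E].
Definition Wset (c : R) (u0 : V -> R) (B : set V) (t : R) : set V :=
  [set x | exists2 y, B y & Wpt c u0 y t x].
Definition Xset (c : R) (u0 : V -> R) (B : set V) (t : R) : set V :=
  Wset c u0 B t `&` Wset c u0 (closure (~` B)) t.

Definition u0_hyp (u0 : V -> R) : Prop :=
  (forall x y, vle x y -> u0 x <= u0 y) /\
  (forall x0 : V, exists r : R, 0 < r /\ exists L : R, forall x y : V,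
      `|x - x0| < r -> `|y - x0| < r -> `|u0 x - u0 y| <= L * `|x - y|) /\
  (forall b : V, forall C : R, exists M : R, forall y, vle y b -> M <= supnorm y ->
      supnorm y `^ (- expo) * u0 y <= - C).

End Defs.

(* Main.v *)
Require Import Defs.
From HB Require Import structures.
From mathcomp Require Import all_boot all_order all_algebra.
From mathcomp Require Import all_classical all_reals all_analysis.
From mathcomp Require Import ring lra zify.
Import Order.TTheory GRing.Theory Num.Theory.
Import numFieldNormedType.Exports.
Local Open Scope classical_set_scope.
Local Open Scope ring_scope.
Set Implicit Arguments.
Unset Strict Implicit.
Unset Printing Implicit Defensive.

(** The optimal starting points in the variational formula for [sigma_n] converge, after
    scaling, to the points [y] that realize the supremum defining [u(x, t)]. Heights are
    integers, so suprema are attained, and [x] lies in [A_n(nt)] exactly when some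
    optimal starting point of [zeta_n] lies in [A_n(0)] and is optimal for [sigma_n];
    if [x] is not in [A_n(nt)], an optimal point of [sigma_n] lies outside [A_n(0)].
    Limit points of the first kind belong to [B] and those of the second kind to the
    closure of its complement, which gives the three claims by compactness.

    The law of large numbers for [H] over arbitrary boxes is derived from the assumed one
    over cubes at the origin. The probability that a box contains a chain of given length
    depends only on its volume (discretize the box by grids: only the pattern of nonempty
    cells matters). For disjoint cubes of geometrically growing size along the diagonal
    the deviation events are independent and, by hypothesis, almost surely occur finitely
    often, so their probabilities are summable by the converse Borel-Cantelli lemma;
    the direct Borel-Cantelli lemma then applies to any boxes with the same volumes. *)

(** * Chains and grids *)

(** Measurability and laws are given only for counts in boxes, so every chain event is treated as a
    pointwise limit of events about grid patterns. The assumed law of large numbers concerns nested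
    cubes, which share points. If the diagonal corners grow fast enough, the cube between two
    consecutive corners fills almost all of the larger nested cube, and the rest is covered by d+1
    thin slabs containing only short chains. The slab bound and the control of remote starting
    points come from one first-moment estimate: in a box of volume at most s^(d+1), a chain of
    length k >= 2es has probability at most 2^(-k). Borel-Cantelli gives limits only along geometric
    sequences of dilations, and only countably many boxes can be treated at once. Monotonicity of H
    in its corners turns this into bounds uniform over neighbourhoods and over all large n. From the
    record [good] up to its almost sure verification, the argument concerns one fixed outcome. *)

Section Chains.
Variables (R : realType) (d : nat).
Local Notation V := 'rV[R]_d.
Local Notation pt := (V * R)%type.

(* The coordinates of R^d x R are indexed by [option 'I_d], [None] being time. *)
Definition ce (p : pt) (o : option 'I_d) : R :=
  if o is Some i then p.1 ord0 i else p.2.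
Definition mkpt (f : option 'I_d -> R) : pt := (\row_i f (Some i), f None).

Lemma ce_mkpt f o : ce (mkpt f) o = f o.
Proof. by case: o => [i|] //=; rewrite mxE. Qed.

Lemma boxE (a b p : pt) : box a b p <-> forall o, ce a o < ce p o <= ce b o.
Proof.
split=> [[[h1 h2] h3] [i|]|h]; rewrite /ce ?h1 ?h2 //.
split; last exact: (h None).
by split=> i; have /andP[] := h (Some i).
Qed.

Lemma pltE (p q : pt) : plt p q <-> forall o, ce p o < ce q o.
Proof.
split=> [[h1 h2] [i|]|h]; [exact: h1|exact: h2|].
by split; [move=> i; exact: (h (Some i))|exact: (h None)].
Qed.

Lemma big_option (S : Type) (idx : S) (op : Monoid.com_law idx)
    (T : finType) (F : option T -> S) :
  \big[op/idx]_o F o = op (\big[op/idx]_i F (Some i)) (F None).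
Proof.
rewrite (bigD1 None) //= Monoid.mulmC; congr (op _ _).
rewrite (reindex_omap Some id); last by case.
by apply: eq_bigl => i; rewrite eqxx.
Qed.

Lemma volE (a b : pt) : vol a b = \prod_o (ce b o - ce a o).
Proof. by rewrite big_option. Qed.

Definition validbox (a b : pt) : Prop :=
  (forall o, ce a o < ce b o) /\ 0 <= a.2.

Lemma vol_gt0 a b : validbox a b -> 0 < vol a b.
Proof. by move=> [h _]; rewrite volE; apply: prodr_gt0 => o _; rewrite subr_gt0. Qed.

Definition chn (X : set pt) (a b : pt) (k : nat) : Prop :=
  exists f : nat -> pt, (forall i, (i < k)%N -> X (f i) /\ box a b (f i)) /\
    (forall i, (i.+1 < k)%N -> plt (f i) (f i.+1)).

Definition pltb : rel pt := fun p q => `[< plt p q >].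

Lemma pltb_trans : transitive pltb.
Proof.
move=> q p r /asboolP/pltE h1 /asboolP/pltE h2; apply/asboolP/pltE => o.
exact: lt_trans (h1 o) (h2 o).
Qed.

Lemma chn_seqP X a b k : chn X a b k <->
  exists s : seq pt, [/\ size s = k, sorted pltb s &
    {in s, forall p, X p /\ box a b p}].
Proof.
split=> [[f [h1 h2]]|[s [<- /(sortedP (0, 0)) h1 h2]]].
  exists (mkseq f k); split; first by rewrite size_mkseq.
    apply/(sortedP (0, 0)) => i; rewrite size_mkseq => ik.
    by rewrite !nth_mkseq ?(ltnW ik) //; apply/asboolP/h2.
  by move=> p /mapP[i]; rewrite mem_iota => /andP[_ ik] ->; apply: h1.
exists (nth (0, 0) s); split=> i ik; first by apply: h2; rewrite mem_nth.
exact/asboolP/h1.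
Qed.

Lemma chn_leq X a b k l : (k <= l)%N -> chn X a b l -> chn X a b k.
Proof.
move=> kl [f [h1 h2]]; exists f; split=> i ik; first exact/h1/(leq_trans ik).
exact/h2/(leq_trans ik).
Qed.

Lemma chn_sub X a b a' b' k : (forall o, ce a' o <= ce a o) ->
  (forall o, ce b o <= ce b' o) -> chn X a b k -> chn X a' b' k.
Proof.
move=> ha hb [f [h1 h2]]; exists f; split=> // i ik.
have [Xf /boxE bf] := h1 i ik; split=> //; apply/boxE => o.
by have /andP[h3 h4] := bf o; rewrite (le_lt_trans (ha o)) //= (le_trans h4).
Qed.

Lemma Hlen_ge (X : set pt) (y x : V) t k : chn X (y, 0) (x, t) k -> ((k%:R)%:E <= Hlen X y x t)%E.
Proof. by move=> h; apply: ereal_sup_ubound; exists k. Qed.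

Lemma Hlen_le (X : set pt) (y x : V) t k : ~ chn X (y, 0) (x, t) k -> (Hlen X y x t <= (k%:R)%:E)%E.
Proof.
move=> h; apply: ge_ereal_sup => _ [l hl <-].
rewrite lee_fin ler_nat leqNgt; apply/negP => kl; apply: h.
exact: (chn_leq (ltnW kl)).
Qed.

Lemma Hlen_gt (X : set pt) (y x : V) t (r : R) : (r%:E < Hlen X y x t)%E ->
  exists2 k, r < k%:R & chn X (y, 0) (x, t) k.
Proof. by move=> /ereal_sup_gt[_ [k hk <-]]; rewrite lte_fin => rk; exists k. Qed.

Lemma Hlen_ge0 (X : set pt) (y x : V) t : (0 <= Hlen X y x t)%E.
Proof. by apply: (@Hlen_ge _ _ _ _ 0%N); exists (fun=> 0); split. Qed.

Lemma Hlen_mono (X : set pt) (y x : V) t y' x' t' : vle y' y -> vle x x' -> t <= t' ->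
  (Hlen X y x t <= Hlen X y' x' t')%E.
Proof.
move=> hy hx ht; apply: ge_ereal_sup => _ [k hk <-]; apply: Hlen_ge.
have {}hk : chn X (y, 0) (x, t) k by exact: hk.
by apply: (chn_sub _ _ hk) => -[i|] //=; [exact: hy|exact: hx].
Qed.

Definition hit (X : set pt) (a b : pt) : bool := `[< exists p, X p /\ box a b p >].

Section Grid.
Variables (a b : pt) (N : nat).
Definition cell := {ffun option 'I_d -> 'I_N}.
Definition cla (g : cell) : pt :=
  mkpt (fun o => ce a o + (ce b o - ce a o) * ((g o)%:R / N%:R)).
Definition clb (g : cell) : pt :=
  mkpt (fun o => ce a o + (ce b o - ce a o) * ((g o).+1%:R / N%:R)).

Definition pattern (X : set pt) : {ffun cell -> bool} :=
  [ffun g => hit X (cla g) (clb g)].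

(** A chain of cells is stored as one strictly increasing index tuple per coordinate, which makes
    the number of such chains a product of binomial coefficients. *)
Definition is_lchain k (T : {ffun option 'I_d -> k.-tuple 'I_N}) :=
  [forall o, sorted ltn (map val (T o))].
Definition lcell k (T : {ffun option 'I_d -> k.-tuple 'I_N}) (j : 'I_k) : cell :=
  [ffun o => tnth (T o) j].
Definition gchain k (B : {ffun cell -> bool}) : bool :=
  [exists T : {ffun option 'I_d -> k.-tuple 'I_N},
     is_lchain T && [forall j : 'I_k, B (lcell T j)]].

Hypothesis ab : validbox a b.

Lemma cell_valid g : validbox (cla g) (clb g).
Proof.
have N0 : (0 < N)%N by apply: leq_trans (ltn_ord (g None)).
have dlt o : 0 < ce b o - ce a o by rewrite subr_gt0; apply: ab.1.
split; first move=> o.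
  rewrite !ce_mkpt ltrD2l ltr_pM2l // ltr_pM2r ?invr_gt0 ?ltr0n //.
  by rewrite ltr_nat.
by rewrite /= addr_ge0 ?(proj2 ab) // mulr_ge0 ?(ltW (dlt None)) ?divr_ge0.
Qed.

Lemma vol_cell g : vol (cla g) (clb g) = vol a b / N%:R ^+ d.+1.
Proof.
have N0 : (0 < N)%N by apply: leq_trans (ltn_ord (g None)).
rewrite !volE -[X in N%:R ^+ X](_ : #|{: option 'I_d}| = d.+1); last first.
  by rewrite card_option card_ord.
rewrite -prodr_const -prodf_div; apply: eq_bigr => o _.
by rewrite !ce_mkpt -[(g o).+1%:R]natr1; ring.
Qed.

Lemma cell_sub g p : box (cla g) (clb g) p -> box a b p.
Proof.
have N0 : (0 < N)%N by apply: leq_trans (ltn_ord (g None)).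
move=> /boxE h; apply/boxE => o.
have dlt : 0 < ce b o - ce a o by rewrite subr_gt0; apply: ab.1.
have := h o; rewrite !ce_mkpt => /andP[h1 h2]; apply/andP; split.
  by apply: le_lt_trans h1; rewrite lerDl mulr_ge0 ?(ltW dlt) // divr_ge0.
apply: (le_trans h2); rewrite -lerBrDl -[leRHS]mulr1 ler_pM2l //.
by rewrite ler_pdivrMr ?ltr0n // mul1r ler_nat.
Qed.

Lemma cell_lt (g g' : cell) p q o : (g o < g' o)%N -> box (cla g) (clb g) p ->
  box (cla g') (clb g') q -> ce p o < ce q o.
Proof.
have N0 : (0 < N)%N by apply: leq_trans (ltn_ord (g None)).
move=> gg /boxE/(_ o)/andP[_ h1] /boxE/(_ o)/andP[h2 _].
apply: (le_lt_trans h1); apply: le_lt_trans h2; rewrite !ce_mkpt lerD2l.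
have dlt : 0 < ce b o - ce a o by rewrite subr_gt0; apply: ab.1.
by rewrite ler_pM2l // ler_pM2r ?invr_gt0 ?ltr0n // ler_nat.
Qed.

Lemma cell_disj (g g' : cell) : g != g' ->
  box (cla g) (clb g) `&` box (cla g') (clb g') = set0.
Proof.
move=> gg; apply/seteqP; split=> // p [h1 h2].
have [ o ] : exists o, g o != g' o.
  apply/existsP; rewrite -negb_forall; apply: contra gg => /forallP h.
  by apply/eqP/ffunP => o; apply/eqP.
rewrite -val_eqE neq_ltn => /orP[] h.
  by have := cell_lt h h1 h2; rewrite ltxx.
by have := cell_lt h h2 h1; rewrite ltxx.
Qed.

Lemma lcell_lt k (T : {ffun option 'I_d -> k.-tuple 'I_N}) (i j : 'I_k) o :
  is_lchain T -> (i < j)%N -> (lcell T i o < lcell T j o)%N.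
Proof.
move=> /forallP/(_ o); rewrite !ffunE.
have szm : size (map val (T o)) = k by rewrite size_map size_tuple.
move=> /(sorted_ltn_nth ltn_trans 0%N) H ij.
have := H i j; rewrite !inE szm !ltn_ord => /(_ isT isT ij).
have N0 : 'I_N := tnth (T o) i.
by rewrite !(nth_map N0) ?size_tuple ?ltn_ord // -!tnth_nth.
Qed.

(** Any choice of one point per cell works: cells are half-open, so a smaller index in a coordinate
    forces a strictly smaller value there. *)
Lemma gchain_chn X k : gchain k (pattern X) -> chn X a b k.
Proof.
move=> /existsP[T /andP[lT /forallP hT]].
have {hT} : forall j : 'I_k, exists p, X p /\ box (cla (lcell T j)) (clb (lcell T j)) p.
  by move=> j; have := hT j; rewrite ffunE => /asboolP.
move=> /choice[f hf].
case: k T lT f hf => [|k] T lT f hf; first by exists (fun=> 0); split.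
exists (fun i => f (inord i)); split=> i ik.
  by have [Xf /cell_sub bf] := hf (inord i).
apply/pltE => o; apply: (cell_lt _ (hf _).2 (hf _).2).
by apply: lcell_lt => //; rewrite !inordK // ltnW.
Qed.

End Grid.

Lemma unit_cell (N : nat) (z : R) : 0 < z <= N%:R ->
  exists i : 'I_N, (i%:R < z <= i.+1%:R).
Proof.
elim: N => [|N IH] /andP[z0 zN]; first by have := lt_le_trans z0 zN; rewrite ltxx.
have [zle|zgt] := leP z N%:R.
  have [i hi] := IH (introT andP (conj z0 zle)).
  by exists (widen_ord (leqnSn N) i).
by exists ord_max; rewrite zgt zN.
Qed.

(** Once the mesh is below the smallest coordinate gap between consecutive points of the chain,
    these points lie in cells whose indices increase strictly in every coordinate. *)
Lemma chn_gchain X a b k : validbox a b -> chn X a b k ->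
  \forall N \near \oo, gchain k (pattern a b N X).
Proof.
move=> ab [f [h1 h2]].
have dlt o : 0 < ce b o - ce a o by rewrite subr_gt0; apply: ab.1.
have : \forall N \near \oo, forall (i : 'I_k) o, (i.+1 < k)%N ->
   ce b o - ce a o < (ce (f i.+1) o - ce (f i) o) * N%:R :> R.
  apply: filter_forall => i; apply: filter_forall => o.
  case: ltnP => [ik|_]; last by apply: nearW.
  have /pltE/(_ o) : plt (f i) (f i.+1) by exact: h2.
  rewrite -subr_gt0 => gap.
  near=> N => _; rewrite mulrC -ltr_pdivrMr //; near: N; exact: nbhs_infty_gtr.
move=> gapN; near=> N.
have N0 : 0 < N%:R :> R by near: N; exact: nbhs_infty_gtr.
have gap : forall (i : 'I_k) o, (i.+1 < k)%N ->
   ce b o - ce a o < (ce (f i.+1) o - ce (f i) o) * N%:R :> R by near: N.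
(* Coordinates rescaled so that the cells become the intervals (i, i+1]; consecutive points then
   differ by more than 1. *)
pose z (i : nat) o := (ce (f i) o - ce a o) * N%:R / (ce b o - ce a o).
have zlt i o : (i.+1 < k)%N -> z i o + 1 < z i.+1 o.
  move=> ik; rewrite -ltrBrDl /z -mulrBl -mulrBl ltr_pdivlMr // mul1r.
  have := gap (Ordinal (ltnW ik)) o ik; rewrite /=; lra.
have zin (i : 'I_k) o : 0 < z i o <= N%:R.
  have [_ /boxE/(_ o)/andP[ha hb]] := h1 i (ltn_ord i).
  have ? : 0 < z i o by rewrite divr_gt0 // mulr_gt0 // subr_gt0.
  apply/andP; split=> //; rewrite /z.
  by rewrite ler_pdivrMr // mulrC ler_pM2l // lerB.
have /choice[g0 hg0] (io : 'I_k * option 'I_d) :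
    exists g : 'I_N, g%:R < z io.1 io.2 <= g.+1%:R by exact: unit_cell.
pose g i o := g0 (i, o); have hg i o : (g i o)%:R < z i o <= (g i o).+1%:R.
  exact: (hg0 (i, o)).
apply/existsP; exists [ffun o => [tuple g j o | j < k]]; apply/andP; split.
  apply/forallP => o; rewrite ffunE.
  have sz : size (map val [tuple g j o | j < k]) = k by rewrite size_map size_tuple.
  apply/(sortedP 0%N) => i; rewrite sz => ik.
  have N1 : 'I_N := g (Ordinal ik) o.
  rewrite !(nth_map N1) ?size_tuple ?(ltnW ik) //.
  have tn l (hl : (l < k)%N) : nth N1 [tuple g j o | j < k] l = g (Ordinal hl) o.
    have := tnth_nth N1 [tuple g j o | j < k] (Ordinal hl).
    by rewrite tnth_mktuple => ->.
  rewrite (tn _ ik) (tn _ (ltnW ik)).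
  have /andP[h3 _] := hg (Ordinal (ltnW ik)) o.
  have /andP[_ h4] := hg (Ordinal ik) o.
  have := zlt i o ik; move: h3 h4 => /= h3 h4 h5.
  by rewrite -ltnS -(ltr_nat R) -natr1; apply: lt_le_trans h4; lra.
apply/forallP => j; rewrite ffunE; apply/asboolP; exists (f j).
have [Xf bf] := h1 j (ltn_ord j); split=> //; apply/boxE => o.
rewrite !ce_mkpt !ffunE tnth_mktuple.
have /andP[h3 h4] := hg j o.
have zE : ce (f j) o = ce a o + (ce b o - ce a o) * (z j o / N%:R).
  by rewrite /z; field; rewrite !gt_eqF // dlt.
rewrite zE ltrD2l lerD2l ltr_pM2l // ler_pM2l // ltr_pM2r ?invr_gt0 //.
by rewrite ler_pM2r ?invr_gt0 // h3 h4.
Unshelve. all: by end_near. Qed.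

Lemma gchain_eventually X a b k : validbox a b ->
  \forall N \near \oo, (gchain k (pattern a b N X) <-> chn X a b k).
Proof.
move=> ab; have [h|h] := pselect (chn X a b k).
  by apply: filterS (chn_gchain ab h) => N hN; split.
by apply: nearW => N; split=> // /(gchain_chn ab).
Qed.

End Chains.

(** * Probabilities of chains in Poisson boxes *)

Section Poisson.
Variables (R : realType) (d : nat) (dm : measure_display) (Om : measurableType dm)
  (P : probability Om R) (pts : Om -> set ('rV[R]_d * R)).
Local Notation V := 'rV[R]_d.
Local Notation pt := (V * R)%type.

Definition pr (E : set Om) : R := fine (P E).

Lemma prE E : measurable E -> P E = (pr E)%:E.
Proof. by move=> mE; rewrite /pr fineK // fin_num_measure. Qed.

Lemma pr_ge0 E : 0 <= pr E.
Proof. exact: fine_ge0. Qed.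

Lemma pr_setC E : measurable E -> pr (~` E) = 1 - pr E.
Proof.
move=> mE; apply: EFin_inj; rewrite -prE; last exact: measurableC.
by rewrite probability_setC // prE // EFinB.
Qed.

Lemma pr_le1 E : measurable E -> pr E <= 1.
Proof. by move=> mE; rewrite -lee_fin -prE // probability_le1. Qed.

Lemma le_pr E F : measurable E -> measurable F -> E `<=` F -> pr E <= pr F.
Proof. by move=> mE mF EF; rewrite -lee_fin -!prE // le_measure // inE. Qed.

Lemma pr_setU E F : measurable E -> measurable F -> E `&` F = set0 ->
  pr (E `|` F) = pr E + pr F.
Proof.
move=> mE mF EF; apply: EFin_inj; rewrite EFinD -!prE //; last exact: measurableU.
by rewrite measureU.
Qed.

Lemma pr_setU_le E F : measurable E -> measurable F -> pr (E `|` F) <= pr E + pr F.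
Proof.
move=> mE mF; rewrite -lee_fin EFinD -!prE //; last exact: measurableU.
exact: measureU2.
Qed.

(** [E] is the upper limit of the [E_ n], and its complement is that of their complements.
    Continuity of [P] along both decreasing unions squeezes [P (E_ n)]. *)
Lemma pr_eventually (E_ : nat -> set Om) E : (forall n, measurable (E_ n)) ->
  (forall w, \forall n \near \oo, (E_ n w <-> E w)) ->
  measurable E /\ (pr (E_ n) @[n --> \oo] --> pr E).
Proof.
have step (G_ : nat -> set Om) G :
    (forall w, \forall n \near \oo, (G_ n w <-> G w)) -> lim_sup_set G_ = G.
  move=> hG; apply/seteqP; split=> w.
    move=> h; have [m _ hm] := hG w; have [n /= mn Gn] := h m I.
    by apply/(hm n).
  move=> Gw n _; have [m _ hm] := hG w.
  exists (maxn n m) => /=; first exact: leq_maxl.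
  by apply/(hm (maxn n m)) => //=; exact: leq_maxr.
move=> mE hE.
have mC n : measurable (~` E_ n) by exact: measurableC.
have hC w : \forall n \near \oo, ((~` E_ n) w <-> (~` E) w).
  by apply: filterS (hE w) => n [h1 h2]; split=> h3 h4; apply: h3; auto.
have m_sup : measurable E.
  rewrite -(step _ _ hE); apply: bigcap_measurable => // k _.
  exact: bigcup_measurable.
split=> //; apply: fine_cvg.
have mb (F : nat -> set Om) n : (forall k, measurable (F k)) ->
    measurable (\bigcup_(k >= n) F k).
  by move=> mF; apply: bigcup_measurable => k _.
rewrite -prE //.
have up : P (\bigcup_(k >= n) E_ k) @[n --> \oo] --> P E.
  rewrite -(step _ _ hE); apply: lim_sup_set_cvg => //.
  by apply: (le_lt_trans (probability_le1 _ _)); rewrite ?ltry //; exact: mb.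
have dn : (1 - P (\bigcup_(k >= n) ~` E_ k))%E @[n --> \oo] --> P E.
  have -> : P E = (1 - P (~` E))%E.
    by rewrite -probability_setC ?setCK //; exact: measurableC.
  apply: cvgeB => //; first exact: cvg_cst.
  rewrite -(step _ _ hC); apply: lim_sup_set_cvg => //.
  by apply: (le_lt_trans (probability_le1 _ _)); rewrite ?ltry //; exact: mb.
apply: (squeeze_cvge _ dn up); apply: nearW => n; apply/andP; split.
  rewrite -probability_setC; last exact: mb.
  apply: le_measure; rewrite ?inE //; first by apply: measurableC; exact: mb.
  move=> w h; apply: contrapT => h1; apply: h; exists n => //=.
apply: le_measure; rewrite ?inE //; first exact: mb.
by move=> w h; exists n => /=.
Qed.

Lemma pr_has (T : eqType) (s : seq T) (E : T -> set Om) : (forall x, measurable (E x)) ->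
  measurable [set w | exists2 x, x \in s & E x w] /\
  pr [set w | exists2 x, x \in s & E x w] <= \sum_(x <- s) pr (E x).
Proof.
move=> mE; elim: s => [|x s [mIH IH]].
  rewrite (_ : mkset _ = set0); last by apply/seteqP; split=> w //= -[].
  by split=> //; rewrite big_nil /pr measure0.
rewrite (_ : mkset _ = E x `|` [set w | exists2 x, x \in s & E x w]); last first.
  apply/seteqP; split=> w /=.
    by move=> [y]; rewrite inE => /predU1P[->|ys] Ey; [left|right; exists y].
  move=> [Ex|[y ys Ey]]; first by exists x; rewrite // mem_head.
  by exists y; rewrite // inE ys orbT.
split; first exact: measurableU.
by rewrite big_cons (le_trans (pr_setU_le _ _)) // lerD2l.
Qed.

Lemma pr_mem (T : eqType) (s : seq T) (f : Om -> T) : uniq s ->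
  (forall x, measurable [set w | f w = x]) ->
  measurable [set w | f w \in s] /\
  pr [set w | f w \in s] = \sum_(x <- s) pr [set w | f w = x].
Proof.
move=> us mE; elim: s us => [|x s IH] /=.
  move=> _; rewrite (_ : mkset _ = set0); last by apply/seteqP; split=> w.
  by split=> //; rewrite big_nil /pr measure0.
move=> /andP[xs /IH[mIH {}IH]].
rewrite (_ : mkset _ = [set w | f w = x] `|` [set w | f w \in s]); last first.
  apply/seteqP; split=> w /=; rewrite inE.
    by move=> /predU1P[->|ys]; [left|right].
  by move=> [->|->]; rewrite ?eqxx ?orbT.
split; first exact: measurableU.
rewrite big_cons -IH pr_setU //; apply/seteqP; split=> w //= -[e h].
by rewrite -e h in xs.
Qed.

Hypothesis ppp : rate_one_poisson P pts.

(** Law of the indicator that a Poisson variable of mean [v] is nonzero. *)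
Definition bern (v : R) (x : bool) : R := if x then 1 - expR (- v) else expR (- v).

Section Family.
Variables (I : finType) (a b : I -> pt).
Hypothesis ab : forall i, validbox (a i) (b i).
Hypothesis dis : forall i j, i != j -> box (a i) (b i) `&` box (a j) (b j) = set0.
Local Notation ht i w := (hit (pts w) (a i) (b i)).

Lemma void_law (A : {set I}) :
  measurable [set w | forall i, i \in A -> ~~ ht i w] /\
  pr [set w | forall i, i \in A -> ~~ ht i w] =
    \prod_(i in A) expR (- vol (a i) (b i)).
Proof.
have [] := ppp.2 #|A| (a \o enum_val) (b \o enum_val) (fun=> 0%N).
- move=> i /=; have [h1 h2] := ab (enum_val i); split.
    by move=> j; exact: (h1 (Some j)).
  by rewrite h2 /=; exact: (h1 None).
- by move=> i j ij; apply: dis; apply: contra ij => /eqP/enum_val_inj ->.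
rewrite (_ : mkset _ = [set w | forall i, i \in A -> ~~ ht i w]); last first.
  apply/seteqP; split=> w /= h i.
    move=> iA; have := h (enum_rank_in iA i).
    rewrite enum_rankK_in // II0 card_eq0 => /eqP h0; apply/asboolPn => -[p hp].
    by have : (pts w `&` box (a i) (b i)) p by []; rewrite h0.
  rewrite II0 card_eq0; apply/eqP/seteqP; split=> // p hp.
  have /h/asboolPn : enum_val i \in A by exact: enum_valP.
  by apply; exists p.
move=> mE; rewrite prE // => -[->]; split=> //.
rewrite [RHS]big_enum_val /=; apply: eq_bigr => i _.
by rewrite expr0 mulr1 fact0 divr1.
Qed.

(** Inclusion-exclusion from the void probabilities, by induction on the size of [T]: requiring a
    hit in cell j removes from the event without that requirement the part where j is empty. *)
Lemma hit_law (A T : {set I}) : (forall i, i \in A -> i \notin T) ->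
  measurable [set w | (forall i, i \in A -> ~~ ht i w) /\ (forall i, i \in T -> ht i w)] /\
  pr [set w | (forall i, i \in A -> ~~ ht i w) /\ (forall i, i \in T -> ht i w)] =
    (\prod_(i in A) expR (- vol (a i) (b i))) *
    \prod_(i in T) (1 - expR (- vol (a i) (b i))).
Proof.
move En : #|T| => n; elim: n A T En => [|n IH] A T En AT.
  move/eqP: En; rewrite cards_eq0 => /eqP ->.
  rewrite big_set0 mulr1 (_ : mkset _ = [set w | forall i, i \in A -> ~~ ht i w]).
    exact: void_law.
  apply/seteqP; split=> w /=; first by case.
  by move=> h; split=> // i; rewrite inE.
have [j jT] : exists j, j \in T by apply/set0Pn; rewrite -cards_eq0 En.
have jA : j \notin A by apply/negP => /AT; rewrite jT.
have En' : #|T :\ j| = n by move: En; rewrite (cardsD1 j) jT => -[].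
have AT' i : i \in A -> i \notin T :\ j.
  by move=> /AT; apply: contra => /setD1P[].
have AT'' i : i \in j |: A -> i \notin T :\ j.
  by rewrite inE => /orP[/set1P ->|/AT' //]; rewrite !inE eqxx.
have [m1 e1] := IH _ _ En' AT'; have [m2 e2] := IH _ _ En' AT''.
move: m1 e1 m2 e2; set E1 := mkset _; set E2 := mkset _ => m1 e1 m2 e2.
have E21 : E2 `<=` E1.
  by move=> w [h1 h2]; split=> // i iA; apply: h1; rewrite inE iA orbT.
rewrite (_ : mkset _ = E1 `\` E2); last first.
  apply/seteqP; split=> w.
    move=> [h1 h2]; split; first by split=> // i /setD1P[_]; exact: h2.
    by move=> [/(_ j)]; rewrite setU11 h2 // => /(_ isT).
  move=> [[h1 h2] h3]; split=> // i iT.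
  have [->|ij] := eqVneq i j; last by apply: h2; rewrite !inE ij.
  apply: contrapT => /negP hj; apply: h3; split=> // l.
  by rewrite !inE => /predU1P[->|/h1].
split; first exact: measurableD.
have := @pr_setU (E1 `\` E2) E2 (measurableD m1 m2) m2.
rewrite setDE -setIA setICl setI0 -setDE => /(_ erefl).
rewrite setUC setDUK // e1 e2 (big_setU1 _ jA) /= => H.
have -> : pr (E1 `\` E2) = \prod_(i in A) expR (- vol (a i) (b i)) *
   \prod_(i in T :\ j) (1 - expR (- vol (a i) (b i))) -
   expR (- vol (a j) (b j)) * \prod_(i in A) expR (- vol (a i) (b i)) *
   \prod_(i in T :\ j) (1 - expR (- vol (a i) (b i))) by rewrite H addrK.
by rewrite [in RHS](big_setD1 j jT) /=; ring.
Qed.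

Lemma pattern_eq_law (B : {ffun I -> bool}) :
  measurable [set w | [ffun i => ht i w] = B] /\
  pr [set w | [ffun i => ht i w] = B] = \prod_i bern (vol (a i) (b i)) (B i).
Proof.
have := @hit_law [set i | ~~ B i]%SET [set i | B i]%SET.
rewrite (_ : mkset _ = [set w | [ffun i => ht i w] = B]); last first.
  apply/seteqP; split=> w /=.
    move=> [h1 h2]; apply/ffunP => i; rewrite ffunE.
    case Bi: (B i); first by apply: h2; rewrite inE.
    by apply/negbTE; apply: h1; rewrite inE Bi.
  by move=> <-; split=> i; rewrite inE ffunE.
move=> /(_ _)[].
  by move=> i; rewrite !inE.
move=> mE ->; split=> //.
rewrite [RHS](bigID B) /= mulrC; congr (_ * _).
  by apply: eq_big => i; rewrite inE // => ->.
by apply: eq_big => i; rewrite inE // => /negbTE ->.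
Qed.

Lemma pattern_event_law (F : pred {ffun I -> bool}) :
  measurable [set w | F [ffun i => ht i w]] /\
  pr [set w | F [ffun i => ht i w]] =
    \sum_(B | F B) \prod_i bern (vol (a i) (b i)) (B i).
Proof.
have := @pr_mem _ (enum F) (fun w => [ffun i => ht i w]) (enum_uniq _)
  (fun B => (pattern_eq_law B).1).
rewrite (_ : mkset _ = [set w | F [ffun i => ht i w]]); last first.
  by apply/seteqP; split=> w /=; rewrite mem_enum.
move=> [mE ->]; split=> //; rewrite big_enum_cond /=.
apply: eq_big => [B|B _]; first by rewrite andbT.
exact: (pattern_eq_law B).2.
Qed.

End Family.

Lemma grid_law a b N (f : pred {ffun cell d N -> bool}) : validbox a b ->
  measurable [set w | f (pattern a b N (pts w))] /\
  pr [set w | f (pattern a b N (pts w))] =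
    \sum_(C | f C) \prod_g bern (vol a b / N%:R ^+ d.+1) (C g).
Proof.
move=> ab.
have [mE ->] := @pattern_event_law _ (cla a b (N := N)) (clb a b (N := N))
  (cell_valid ab) (@cell_disj _ _ _ _ _ ab) f.
split=> //; apply: eq_bigr => C _; apply: eq_bigr => g _.
by rewrite vol_cell.
Qed.

(** The cells of all the grids together form one disjoint family, indexed by pairs; its product law,
    summed over patterns satisfying every [f i], factorizes by distributivity. *)
Lemma grid_indep r (a b : 'I_r -> pt) N (f : 'I_r -> pred {ffun cell d N -> bool}) :
  (forall i, validbox (a i) (b i)) ->
  (forall i j, i != j -> box (a i) (b i) `&` box (a j) (b j) = set0) ->
  measurable [set w | forall i, f i (pattern (a i) (b i) N (pts w))] /\
  pr [set w | forall i, f i (pattern (a i) (b i) N (pts w))] =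
    \prod_i pr [set w | f i (pattern (a i) (b i) N (pts w))].
Proof.
move=> ab dis.
pose A (x : 'I_r * cell d N) := cla (a x.1) (b x.1) x.2.
pose B (x : 'I_r * cell d N) := clb (a x.1) (b x.1) x.2.
pose unc (C : {ffun 'I_r -> {ffun cell d N -> bool}}) :
  {ffun 'I_r * cell d N -> bool} := [ffun x => C x.1 x.2].
pose cur (C : {ffun 'I_r * cell d N -> bool}) :
  {ffun 'I_r -> {ffun cell d N -> bool}} := [ffun i => [ffun g => C (i, g)]].
have uncK : cancel unc cur.
  by move=> C; apply/ffunP => i; apply/ffunP => g; rewrite !ffunE.
have curK : cancel cur unc.
  by move=> C; apply/ffunP => -[i g]; rewrite !ffunE.
have := @pattern_event_law _ A B _ _ (fun C => [forall i, f i (cur C i)]).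
rewrite (_ : mkset _ = [set w | forall i, f i (pattern (a i) (b i) N (pts w))]).
  move=> /(_ _ _)[]; last first.
  - move=> mE ->; split=> //.
    transitivity (\prod_i \sum_(C | f i C)
        \prod_g bern (vol (a i) (b i) / N%:R ^+ d.+1) (C g)); last first.
      by apply: eq_bigr => i _; have [_ ->] := grid_law (f i) (ab i).
    under [in RHS]eq_bigr do rewrite big_mkcond.
    rewrite bigA_distr_bigA /= big_mkcond (reindex unc) /=; last first.
      by exists cur => C _.
    apply: eq_bigr => C _; rewrite uncK.
    case: ifPn => [/forallP h|].
      under [RHS]eq_bigr do rewrite h.
      rewrite pair_bigA /=; apply: eq_bigr => -[i g] _.
      by rewrite ffunE /= /A /B /= vol_cell.
    move=> /forallPn[i hi]; rewrite (bigD1 i) //= (negbTE hi) mul0r //.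
  - move=> [i g] [j g'] /=; have [->|ij] := eqVneq i j.
      move=> gg; apply: cell_disj => //; apply: contra gg => /= /eqP ->.
      by rewrite eqxx.
    move=> _; apply/seteqP; split=> // p [h1 h2]; rewrite -(dis _ _ ij).
    by split; [exact: cell_sub h1|exact: cell_sub h2].
  - by move=> [i g]; exact: cell_valid.
apply/seteqP; split=> w /=.
  move=> /forallP h i; have := h i; congr (f i _ : Prop).
  by apply/ffunP => g; rewrite !ffunE.
move=> h; apply/forallP => i; have := h i; congr (f i _ : Prop).
by apply/ffunP => g; rewrite !ffunE.
Qed.

Definition chain_event a b k := [set w | chn (pts w) a b k].

(** For each outcome the grid event agrees with the chain event at all fine enough meshes;
    measurability of chain events is obtained here. *)
Lemma chain_event_cvg a b k : validbox a b -> measurable (chain_event a b k) /\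
  (pr [set w | gchain k (pattern a b N (pts w))] @[N --> \oo] -->
   pr (chain_event a b k)).
Proof.
move=> ab; apply: pr_eventually.
  by move=> N; have [] := grid_law (gchain (N := N) k) ab.
by move=> w; exact: gchain_eventually.
Qed.

Lemma measurable_chain_event a b k : validbox a b -> measurable (chain_event a b k).
Proof. by move=> /(chain_event_cvg k)[]. Qed.

Lemma pr_chain_vol a b a' b' k : validbox a b -> validbox a' b' ->
  vol a b = vol a' b' -> pr (chain_event a b k) = pr (chain_event a' b' k).
Proof.
move=> ab ab' vv; have [_ c1] := chain_event_cvg k ab.
have [_ c2] := chain_event_cvg k ab'; apply: (cvg_unique _ c1) => //.
rewrite (_ : (fun N : nat => _) = (fun N =>
  pr [set w | gchain k (pattern a' b' N (pts w))])) //.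
apply/funext => N.
have [_ ->] := grid_law (gchain (N := N) k) ab.
by have [_ ->] := grid_law (gchain (N := N) k) ab'; rewrite vv.
Qed.

Lemma cvg_prodr r (u : nat -> 'I_r -> R) (l : 'I_r -> R) :
  (forall i, u n i @[n --> \oo] --> l i) ->
  \prod_i u n i @[n --> \oo] --> \prod_i l i.
Proof.
elim: r u l => [|r IH] u l h.
  under eq_fun do rewrite big_ord0; rewrite big_ord0; exact: cvg_cst.
under eq_fun do rewrite big_ord_recl; rewrite big_ord_recl.
by apply: cvgM; [exact: h|apply: IH => i; exact: h].
Qed.

(** The boolean [s] selects the events or their complements, so that upper and lower deviations
    share one argument. *)
Lemma chain_event_indep r (a b : 'I_r -> pt) (k : 'I_r -> nat) (s : bool) :
  (forall i, validbox (a i) (b i)) ->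
  (forall i j, i != j -> box (a i) (b i) `&` box (a j) (b j) = set0) ->
  pr [set w | forall i, chn (pts w) (a i) (b i) (k i) <-> s] =
    \prod_i pr [set w | chn (pts w) (a i) (b i) (k i) <-> s].
Proof.
move=> ab dis.
pose f N (i : 'I_r) : pred {ffun cell d N -> bool} := fun C => gchain (k i) C == s.
have fE N i (C : {ffun cell d N -> bool}) : f N i C <-> (gchain (k i) C <-> s).
  rewrite /f; case: (gchain _ _) (s) => [] [] //; split=> //; first by case=> ->.
  by case=> _ ->.
have ev w i : \forall N \near \oo, (f N i (pattern (a i) (b i) N (pts w)) <->
    (chn (pts w) (a i) (b i) (k i) <-> s)).
  apply: filterS (gchain_eventually (pts w) (k i) (ab i)) => N h.
  rewrite fE; tauto.
have [_ c1] : measurable [set w | forall i, chn (pts w) (a i) (b i) (k i) <-> s] /\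
   (pr [set w | forall i, f N i (pattern (a i) (b i) N (pts w))] @[N --> \oo] -->
   pr [set w | forall i, chn (pts w) (a i) (b i) (k i) <-> s]).
  apply: pr_eventually.
    by move=> N; have [] := grid_indep (f N) ab dis.
  move=> w; have evw : \forall N \near \oo, forall i,
      (f N i (pattern (a i) (b i) N (pts w)) <->
       (chn (pts w) (a i) (b i) (k i) <-> s)).
    by apply: filter_forall => i; exact: ev.
  by apply: filterS evw => N h; split=> h1 i; exact/h/h1.
apply: (cvg_unique _ c1) => //.
rewrite (_ : (fun N : nat => _) = (fun N => \prod_i
   pr [set w | f N i (pattern (a i) (b i) N (pts w))])); last first.
  by apply/funext => N; have [_ ->] := grid_indep (f N) ab dis.
apply: cvg_prodr => i.
have [|w|_ ci] := @pr_eventually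
  (fun N => [set w | f N i (pattern (a i) (b i) N (pts w))])
  [set w | chn (pts w) (a i) (b i) (k i) <-> s].
- by move=> N; have [] := grid_law (f N i) (ab i).
- exact: ev.
- exact: ci.
Qed.

Lemma card_lchain N k :
  #|[set T : {ffun option 'I_d -> k.-tuple 'I_N} | is_lchain T]%SET| = ('C(N, k) ^ d.+1)%N.
Proof.
rewrite -card_ltn_sorted_tuples -[X in (_ ^ X)%N](_ : #|{: option 'I_d}| = _).
  rewrite -card_ffun_on; apply: eq_card => T; rewrite inE.
  apply/forallP/ffun_onP => h o; have := h o; rewrite inE //.
by rewrite card_option card_ord.
Qed.

(** Union bound over chains of cells; a cell of volume v is hit with probability 1 - exp(-v) <=
    v. *)
Lemma pr_gchain_le a b N k : validbox a b ->
  pr [set w | gchain k (pattern a b N (pts w))] <=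
    ('C(N, k) ^ d.+1)%:R * (vol a b / N%:R ^+ d.+1) ^+ k.
Proof.
move=> ab.
pose E (T : {ffun option 'I_d -> k.-tuple 'I_N}) :=
  [set w | is_lchain T && [forall j, pattern a b N (pts w) (lcell T j)]].
have mE T : measurable (E T).
  by have [] := grid_law (fun C => is_lchain T && [forall j, C (lcell T j)]) ab.
have prE T : is_lchain T -> pr (E T) <= (vol a b / N%:R ^+ d.+1) ^+ k.
  move=> lT.
  (* The cells of one chain are distinct, so their hit probabilities multiply. *)
  have inj : injective (lcell T).
    move=> i j ij; case: (ltngtP i j) => [h|h|/val_inj //].
      by have := lcell_lt None lT h; rewrite ij ltnn.
    by have := lcell_lt None lT h; rewrite ij ltnn.
  have := @hit_law _ (cla a b (N := N)) (clb a b (N := N))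
    (cell_valid ab) (@cell_disj _ _ _ _ _ ab) finset.set0 (lcell T @: 'I_k)%SET.
  rewrite (_ : mkset _ = E T); last first.
    apply/seteqP; split=> w /=.
      move=> [_ h]; rewrite /E /= lT /=; apply/forallP => j.
      by rewrite ffunE h // imset_f.
    rewrite /E /= => /andP[_ /forallP h]; split=> g; first by rewrite inE.
    by move=> /imsetP[j _ ->]; have := h j; rewrite ffunE.
  move=> /(_ _)[|_ ->]; first by move=> i; rewrite inE.
  rewrite big_set0 mul1r big_imset /=; last by move=> i j _ _; exact: inj.
  rewrite -[X in _ ^+ X](card_ord k) -prodr_const; apply: ler_prod => j _.
  have v0 := vol_gt0 (cell_valid ab (lcell T j)).
  rewrite -(vol_cell a b (lcell T j)) subr_ge0 -expR0 ler_expR oppr_le0 (ltW v0) /=.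
  rewrite expR0 lerBlDr -lerBlDl.
  have := expR_ge1Dx (- vol (cla a b (lcell T j)) (clb a b (lcell T j))); lra.
have [_ h] := pr_has (enum [set T : {ffun option 'I_d -> k.-tuple 'I_N} | is_lchain T]%SET) mE.
rewrite (_ : mkset _ = [set w | exists2 T, T \in
  enum [set T : {ffun option 'I_d -> k.-tuple 'I_N} | is_lchain T]%SET & E T w]).
  apply: (le_trans h); rewrite big_enum /=.
  rewrite -card_lchain mulr_natl -sumr_const; apply: ler_sum => T.
  by rewrite inE; exact: prE.
apply/seteqP; split=> w /=.
  move=> /existsP[T h1]; exists T; last exact: h1.
  by rewrite mem_enum inE; case/andP: h1.
by move=> [T _ h1]; apply/existsP; exists T; exact: h1.
Qed.

Lemma ffact_le_expn n m : (n ^_ m <= n ^ m)%N.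
Proof.
rewrite ffact_prod -[X in (_ <= _ ^ X)%N]card_ord -prod_nat_const.
by apply: leq_prod => i _; exact: leq_subr.
Qed.

(** Since 'C(N, k) <= N^k / k!, the powers of N cancel in the grid bound, and N tends to
    infinity. *)
Lemma pr_chain_le a b k : validbox a b ->
  pr (chain_event a b k) <= vol a b ^+ k / (k`!%:R ^+ d.+1).
Proof.
move=> ab; have [_ c1] := chain_event_cvg k ab.
apply: (ler_cvg_to c1 (cvg_cst _)); near=> N.
have N0 : (0 < N)%N by near: N; exact: nbhs_infty_gt.
apply: (le_trans (pr_gchain_le N k ab)).
rewrite expr_div_n mulrCA ler_wpM2l ?exprn_ge0 ?(ltW (vol_gt0 ab)) //.
rewrite -!natrX ler_pdivrMr ?ltr0n ?expn_gt0 ?N0 //.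
rewrite mulrC ler_pdivlMr ?ltr0n ?expn_gt0 ?fact_gt0 //.
rewrite -natrM ler_nat -expnMn bin_ffact -expnM mulnC expnM.
by rewrite leq_exp2r // ffact_le_expn.
Unshelve. all: by end_near. Qed.

Lemma expR_natX (k : nat) : expR (k%:R : R) = expR 1 ^+ k.
Proof. by rewrite -expRM_natl mulr1. Qed.

(** From s <= k/(2e) and k^k / k! <= e^k one gets s^k / k! <= 2^(-k); the further power d+1 only
    decreases it. *)
Lemma pr_chain_tail a b (s : R) (k : nat) : validbox a b -> 0 <= s ->
  vol a b <= s ^+ d.+1 -> 2 * expR 1 * s <= k%:R ->
  pr (chain_event a b k) <= 2^-1 ^+ k.
Proof.
move=> ab s0 vs sk; apply: (le_trans (pr_chain_le k ab)).
have f0 : 0 < k`!%:R :> R by rewrite ltr0n fact_gt0.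
have e0 : 0 < expR 1 :> R := expR_gt0 1.
have h1 : s ^+ k / k`!%:R <= 2^-1 ^+ k.
  rewrite ler_pdivrMr //.
  apply: (@le_trans _ _ ((k%:R / (2 * expR 1)) ^+ k)).
    rewrite lerXn2r ?nnegrE ?divr_ge0 ?mulr_ge0 ?(ltW e0) //.
    by rewrite ler_pdivlMr ?mulr_gt0 // mulrC.
  rewrite expr_div_n [in leLHS]exprMn invfM mulrCA exprVn ler_pM2l ?invr_gt0 ?exprn_gt0 //.
  rewrite ler_pdivrMr ?exprn_gt0 // -expR_natX -ler_pdivrMl // mulrC.
  (* k^k / k! is a single term of the exponential series at k; k = 0 is checked apart. *)
  case: k {sk f0} => [|k]; first by rewrite expr0 fact0 divr1 expR0.
  have := @expR_ge1Dxn R k.+1%:R k (ler0n _ _); lra.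
apply: (@le_trans _ _ ((s ^+ k / k`!%:R) ^+ d.+1)).
  rewrite expr_div_n ler_pM2r ?invr_gt0 ?exprn_gt0 //.
  by rewrite exprAC lerXn2r ?nnegrE ?exprn_ge0 ?(ltW (vol_gt0 ab)).
apply: (@le_trans _ _ ((2^-1 ^+ k) ^+ d.+1)).
  by rewrite lerXn2r ?nnegrE ?divr_ge0 ?exprn_ge0 // invr_ge0.
have q1 : (2^-1 : R) ^+ k <= 1 by apply: exprn_ile1; lra.
have q0 : 0 <= (2^-1 : R) ^+ k by apply: exprn_ge0; lra.
by rewrite exprS ler_piMr // exprn_ile1.
Qed.

End Poisson.

(** * Law of large numbers *)

Section LLN.
Variables (R : realType) (d : nat) (dm : measure_display) (Om : measurableType dm)
  (P : probability Om R) (pts : Om -> set ('rV[R]_d * R)).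
Local Notation V := 'rV[R]_d.
Local Notation pt := (V * R)%type.
Local Notation pr := (pr P).

Lemma borel_cantelli1 (E : nat -> set Om) (C : R) : (forall n, measurable (E n)) ->
  (forall n, \sum_(k < n) pr (E k) <= C) ->
  {ae P, forall w, \forall k \near \oo, ~ E k w}.
Proof.
move=> mE hC; have : P (lim_sup_set E) = 0%E.
  apply: lim_sup_set_cvg0 => //; apply: (@le_lt_trans _ _ C%:E); last exact: ltry.
  apply: lime_le; first exact: is_cvg_nneseries.
  apply: nearW => n; rewrite big_mkord.
  have := hC n; rewrite -lee_fin -sumEFin; apply: le_trans.
  by apply: lee_sum => k _; rewrite -(prE P (mE k)).
move=> h0; exists (lim_sup_set E); split=> //.
  apply: bigcap_measurable => // k _; exact: bigcup_measurable.
move=> w /= h m _; apply: contrapT => h1; apply: h; exists m => // k /= mk Ek.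
by apply: h1; exists k.
Qed.

Lemma ae_False : ~ {ae P, forall w : Om, False}.
Proof.
move=> [A [mA A0 h]]; have : P setT = 0%E.
  by apply: (subset_measure0 _ mA) => // w _; apply: h.
by rewrite probability_setT => -[] /eqP; rewrite oner_eq0.
Qed.

(* A positive probability of avoiding all [F k] from some rank on bounds the product
   of the [1 - pr (F k)] below, hence the sum of the [pr (F k)] above. *)
Lemma borel_cantelli2 (F : nat -> set Om) : (forall n, measurable (F n)) ->
  (forall m r, pr [set w | forall i : 'I_r, ~ F (m + i)%N w] =
     \prod_(i < r) (1 - pr (F (m + i)%N))) ->
  {ae P, forall w, \forall k \near \oo, ~ F k w} ->
  exists C, forall n, \sum_(k < n) pr (F k) <= C.
Proof.
move=> mF ind aeF.
pose D m := \bigcap_(k in [set k | (m <= k)%N]) ~` F k.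
have mD m : measurable (D m).
  by apply: bigcap_measurableType => k _; exact: measurableC.
(* If every [D m] were null, almost surely none would occur, whereas the hypothesis says that almost
   surely one does. *)
have [m hm] : exists m, 0 < pr (D m).
  apply: contrapT => hno; apply: ae_False.
  have : forall m, {ae P, forall w, ~ D m w}.
    move=> m; exists (D m); split=> //; last by move=> w /= /contrapT.
    apply/eqP; rewrite (prE P (mD m)) eqe eq_le pr_ge0 andbT leNgt.
    by apply/negP => h; apply: hno; exists m.
  move=> /ae_foralln; apply: filterS2 aeF => w [m _ h] /(_ m); apply=> k /= mk.
  exact: h.
exists (m%:R + - ln (pr (D m))) => n.
have le_m k : \sum_(i < k) pr (F (m + i)%N) <= - ln (pr (D m)).
  rewrite lerNr -ler_expR lnK ?posrE //.
  apply: (@le_trans _ _ (pr [set w | forall i : 'I_k, ~ F (m + i)%N w])).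
    apply: le_pr => //; last by move=> w h i; apply: h => /=; exact: leq_addr.
    rewrite (_ : mkset _ = \bigcap_(i in `I_k) ~` F (m + i)%N).
      by apply: bigcap_measurableType => i _; exact: measurableC.
    apply/seteqP; split=> w h i; last exact: (h i (ltn_ord i)).
    by move=> ik; exact: (h (Ordinal ik)).
  rewrite ind -sumrN expR_sum; apply: ler_prod => i _.
  rewrite subr_ge0 pr_le1 //=; have := expR_ge1Dx (- pr (F (m + i)%N)); lra.
apply: (@le_trans _ _ (\sum_(k < m + n) pr (F k))).
  rewrite addnC big_split_ord /= lerDl; apply: sumr_ge0 => i _; exact: pr_ge0.
rewrite big_split_ord /=; apply: lerD; last exact: le_m.
apply: (@le_trans _ _ (\sum_(i < m) 1)); last by rewrite sumr_const card_ord.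
by apply: ler_sum => i _; rewrite pr_le1.
Qed.

Hypothesis ppp : rate_one_poisson P pts.

Let ev a b k (s : bool) := [set w | chn (pts w) a b k <-> s].

Lemma evE a b k s : ev a b k s = if s then chain_event pts a b k else ~` chain_event pts a b k.
Proof.
apply/seteqP; split=> w; case: s; rewrite /ev /chain_event /=; first by case=> _; apply.
- by case=> h _ /h.
- by [].
- by split.
Qed.

Lemma measurable_ev a b k s : validbox a b -> measurable (ev a b k s).
Proof.
move=> ab; rewrite evE; have := measurable_chain_event ppp k ab.
by case: s => // m; exact: measurableC.
Qed.

Lemma chain_transfer (a b a' b' : nat -> pt) (K : nat -> nat) (s : bool) :
  (forall k, validbox (a k) (b k)) -> (forall k, validbox (a' k) (b' k)) ->
  (forall k l, k != l -> box (a k) (b k) `&` box (a l) (b l) = set0) ->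
  (forall k, vol (a k) (b k) = vol (a' k) (b' k)) ->
  {ae P, forall w, \forall k \near \oo, ~ (chn (pts w) (a k) (b k) (K k) <-> s)} ->
  {ae P, forall w, \forall k \near \oo, ~ (chn (pts w) (a' k) (b' k) (K k) <-> s)}.
Proof.
move=> ab ab' dis vv.
have prEv k : pr (ev (a k) (b k) (K k) s) = pr (ev (a' k) (b' k) (K k) s).
  rewrite !evE; have h := pr_chain_vol ppp (K k) (ab k) (ab' k) (vv k).
  case: s => //; rewrite !pr_setC ?h //; exact: (measurable_chain_event ppp).
move=> /(@borel_cantelli2 (fun k => ev (a k) (b k) (K k) s))[].
- by move=> k; exact: measurable_ev.
- move=> m r.
  have dis' (i j : 'I_r) : i != j ->
      box (a (m + i)%N) (b (m + i)%N) `&` box (a (m + j)%N) (b (m + j)%N) = set0.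
    by move=> ij; apply: dis; rewrite eqn_add2l.
  (* Complements stay in the family, with [s] negated, so the product formula applies to them as
     well. *)
  have negE (p : Prop) : (~ (p <-> s)) = (p <-> ~~ s).
    apply/propext; case: (s) => /=; split.
    - by move=> h; split=> // hp; exfalso; apply: h; split.
    - by move=> [h _] [_ hp]; have := h (hp isT).
    - by move=> h; split=> // _; apply: contrapT => hp; apply: h; split.
    - by move=> [_ h] [hf _]; have := hf (h isT).
  have -> : [set w | forall i : 'I_r, ~ ev (a (m + i)%N) (b (m + i)%N) (K (m + i)%N) s w] =
     [set w | forall i : 'I_r, chn (pts w) (a (m + i)%N) (b (m + i)%N) (K (m + i)%N) <-> ~~ s].
    by apply/seteqP; split=> w h i; have := h i; rewrite /ev /= negE.
  rewrite (chain_event_indep ppp (fun i : 'I_r => K (m + i)%N) (~~ s) (fun i => ab _) dis').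
  apply: eq_bigr => i _; rewrite -pr_setC; last exact: measurable_ev.
  congr (pr _); apply/seteqP; split=> w; by rewrite /ev /= negE.
move=> C hC; apply: (@borel_cantelli1 (fun k => ev (a' k) (b' k) (K k) s) C).
  by move=> k; exact: measurable_ev.
by move=> n; under eq_bigr do rewrite -prEv.
Qed.

Definition cub (u : R) : pt := mkpt (fun=> u).

Lemma ce_cub u o : ce (cub u) o = u.
Proof. exact: ce_mkpt. Qed.

Lemma card_coords : #|{: option 'I_d}| = d.+1.
Proof. by rewrite card_option card_ord. Qed.

Lemma vol_cub u v : vol (cub u) (cub v) = (v - u) ^+ d.+1.
Proof.
rewrite volE; under eq_bigr do rewrite !ce_cub.
by rewrite prodr_const card_coords.
Qed.

Lemma valid_cub u v : 0 <= u < v -> validbox (cub u) (cub v).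
Proof. by move=> /andP[u0 uv]; split=> // o; rewrite !ce_cub. Qed.

Lemma size_le_count (T : eqType) (J : finType) (s : seq T) (A : pred T) (B : J -> pred T) :
  {in s, forall p, A p || [exists o, B o p]} ->
  (size s <= count A s + \sum_o count (B o) s)%N.
Proof.
elim: s => [|x s IH] // h; rewrite /= big_split /=.
have {}IH : (size s <= count A s + \sum_o count (B o) s)%N.
  by apply: IH => p ps; apply: h; rewrite inE ps orbT.
have : (0 < A x + \sum_o (B o x : nat))%N.
  have /orP[->//|/existsP[j Bj]] := h x (mem_head _ _).
  by rewrite (bigD1 j) //= Bj addnCA.
lia.
Qed.

Lemma chn_count (X : set pt) a b (s : seq pt) : sorted (@pltb R d) s ->
  {in s, forall p, X p} -> chn X a b (count (fun p => `[< box a b p >]) s).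
Proof.
move=> ss sX; apply/chn_seqP; exists [seq p <- s | `[< box a b p >]]; split.
- by rewrite size_filter.
- exact: (sorted_filter (@pltb_trans R d)).
- by move=> p; rewrite mem_filter => /andP[/asboolP bp /sX].
Qed.

Variable c : R.

Definition lim_at (w : Om) := (fun n : nat =>
  (Hlen (pts w) 0 (n%:R *: onev R d) n%:R * (n%:R^-1)%:E)%E) @ \oo --> c%:E.

Lemma lim_at_bounds w (e : R) : lim_at w -> 0 < e -> \forall n \near \oo,
  (((c - e) * n%:R)%:E < Hlen (pts w) 0 (n%:R *: onev R d) n%:R < ((c + e) * n%:R)%:E)%E.
Proof.
move=> /fine_cvgP[fin_near hfine] e0; near=> n.
have n0 : 0 < n%:R :> R by near: n; exact: nbhs_infty_gtr.
have fin : (Hlen (pts w) 0 (n%:R *: onev R d) n%:R * (n%:R^-1)%:E)%E \is a fin_num.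
  by near: n; exact: fin_near.
rewrite !EFinM -lte_pdivrMr // -lte_pdivlMr // -(fineK fin) !lte_fin.
apply/andP; split; near: n.
  by apply: (cvgr_gt _ hfine); lra.
by apply: (cvgr_lt _ hfine); lra.
Unshelve. all: by end_near. Qed.

Lemma lim_at_ge0 w : lim_at w -> 0 <= c.
Proof.
move=> hw; rewrite leNgt; apply/negP => c0.
have c2 : 0 < - c / 2 by lra.
have [m _ hm] := lim_at_bounds hw c2.
have /andP[_] := hm m.+1 (leqnSn _); apply/negP; rewrite -leNgt.
apply: le_trans (Hlen_ge0 _ _ _ _); rewrite lee_fin.
rewrite pmulr_lle0 ?ltr0n //; lra.
Qed.

Hypothesis d0 : (0 < d)%N.

(** * Disjoint cubes along the diagonal *)

Section Cubes.
Variables (r a e : R).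
Hypothesis hyps : [/\ 2 <= r, 0 < a, 0 < e, 4 * (c + e) <= e * r &
  4 * d.+1%:R * (2 * expR 1) <= e * r].
(** The ratio is a (d+1)-st power so that a slab of thickness u_k in the cube of side u_(k+1) has
    volume (u_(k+1)/r)^(d+1). The factor a/(b-1) in [u] gives the k-th diagonal cube side a b^k. *)
Let b := r ^+ d.+1.
Let u (k : nat) : R := a / (b - 1) * b ^+ k.

Let rb : r <= b.
Proof. by have [r2 _ _ _ _] := hyps; apply: ler_eXnr => //; lra. Qed.
Let b1 : 0 < b - 1.
Proof. have [r2 _ _ _ _] := hyps; have := rb; lra. Qed.
Let al0 : 0 < a / (b - 1).
Proof. by have [_ a0 _ _ _] := hyps; exact: divr_gt0. Qed.
Let u_gt0 k : 0 < u k.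
Proof.
have [r2 a0 e0 rc rd] := hyps; have r_le_b := rb; have b1_gt0 := b1.
by rewrite mulr_gt0 // exprn_gt0 //; have := rb; lra.
Qed.
Let uS k : u k.+1 = b * u k.
Proof.
have [r2 a0 e0 rc rd] := hyps; have r_le_b := rb; have b1_gt0 := b1.
by rewrite /u exprS mulrCA.
Qed.
Let uB k : u k.+1 - u k = a * b ^+ k.
Proof.
have [r2 a0 e0 rc rd] := hyps; have r_le_b := rb; have b1_gt0 := b1.
by rewrite uS /u; field; rewrite gt_eqF.
Qed.
Let u_lt k : u k < u k.+1.
Proof.
have [r2 a0 e0 rc rd] := hyps; have r_le_b := rb; have b1_gt0 := b1.
by rewrite uS ltr_pMl //; have := rb; lra.
Qed.
Let u_le k l : (k <= l)%N -> u k <= u l.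
Proof.
have [r2 a0 e0 rc rd] := hyps; have r_le_b := rb; have b1_gt0 := b1.
by move=> kl; rewrite /u ler_pM2l // ler_weXn2l //; have := rb; lra.
Qed.
(** From b >= r^2 >= 4 and k+1 <= 2^k. Quadratic growth already beats the linear term in k that
    enters through the slab thresholds. *)
Let u_big k : a / (b - 1) * k.+1%:R ^+ 2 <= u k.
Proof.
have [r2 a0 e0 rc rd] := hyps; have r_le_b := rb; have b1_gt0 := b1.
rewrite /u ler_pM2l //.
apply: (@le_trans _ _ ((r ^+ k) ^+ 2)).
  rewrite lerXn2r ?nnegrE ?exprn_ge0 //; first by lra.
  apply: (@le_trans _ _ (2 ^+ k)); last by rewrite lerXn2r ?nnegrE //; lra.
  by rewrite -natrX ler_nat ltn_expl.
rewrite -exprM mulnC exprM lerXn2r ?nnegrE ?exprn_ge0 //; try lra.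
by rewrite /b ler_weXn2l //; lra.
Qed.
Let u_infty (z y : R) : \forall k \near \oo, z + y * k.+1%:R <= u k.+1.
Proof.
have [r2 a0 e0 rc rd] := hyps; have r_le_b := rb; have b1_gt0 := b1.
near=> k.
have k1 : (`|z| + `|y|) / (a / (b - 1)) <= k.+1%:R.
  apply: (@le_trans _ _ k%:R); last by rewrite ler_nat.
  by near: k; exact: nbhs_infty_ger.
apply: le_trans (u_big _).
move: k1; rewrite ler_pdivrMr // => k1.
have k2 : 1 <= k.+1%:R :> R by rewrite ler1n.
have k3 : k.+1%:R <= k.+2%:R :> R by rewrite ler_nat.
have zz : z <= `|z| := ler_norm z.
have yy : y <= `|y| := ler_norm y.
have z0 : 0 <= `|z| := normr_ge0 z.
have h1 : z + y * k.+1%:R <= (`|z| + `|y|) * k.+1%:R.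
  rewrite mulrDl lerD ?ler_wpM2r //; apply: (le_trans zz); exact: ler_peMr.
apply: (le_trans h1); apply: (@le_trans _ _ (a / (b - 1) * k.+1%:R ^+ 2)).
  by rewrite expr2 mulrA ler_wpM2r // mulrC.
by rewrite ler_pM2l // lerXn2r ?nnegrE.
Unshelve. all: by end_near. Qed.

Let G_valid k : validbox (cub (u k)) (cub (u k.+1)).
Proof.
have [r2 a0 e0 rc rd] := hyps; have r_le_b := rb; have b1_gt0 := b1.
by apply: valid_cub; rewrite (ltW (u_gt0 k)) u_lt.
Qed.
Let G_disj k l : k != l ->
  box (cub (u k)) (cub (u k.+1)) `&` box (cub (u l)) (cub (u l.+1)) = set0.
Proof.
have [r2 a0 e0 rc rd] := hyps; have r_le_b := rb; have b1_gt0 := b1.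
have H k' l' : (k' < l')%N -> forall p, box (cub (u k')) (cub (u k'.+1)) p ->
   box (cub (u l')) (cub (u l'.+1)) p -> False.
  move=> kl p /boxE/(_ None); rewrite !ce_cub => /andP[_ h1].
  move=> /boxE/(_ None); rewrite !ce_cub => /andP[h2 _].
  by have := le_lt_trans (le_trans h1 (u_le kl)) h2; rewrite ltxx.
rewrite neq_ltn => /orP[] kl; apply/seteqP; split=> // p [h1 h2].
  exact: (H _ _ kl p).
exact: (H _ _ kl p).
Qed.

(** A chain of the diagonal cube lies in the cube of integer side N at the origin, with N just above
    u_(k+1). The loss (c+e) u_k is at most (e/4) u_(k+1), because r is at least 4(c+e)/e. *)
Lemma cube_upper w (K : nat -> nat) : lim_at w ->
  (forall k, (c + e) * (a * b ^+ k) <= (K k)%:R) ->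
  \forall k \near \oo, ~ chn (pts w) (cub (u k)) (cub (u k.+1)) (K k).
Proof.
have [r2 a0 e0 rc rd] := hyps; have r_le_b := rb; have b1_gt0 := b1.
move=> hw hK; have c0 := lim_at_ge0 hw.
have e4 : 0 < e / 4 by lra.
have [n0 _ hn0] := lim_at_bounds hw e4.
near=> k => hc.
have ub : (c + e / 4) * 2 / e <= u k.+1.
  near: k; apply: filterS (u_infty ((c + e / 4) * 2 / e) 0) => k.
  by rewrite mul0r addr0.
have un0 : n0%:R <= u k.+1.
  near: k; apply: filterS (u_infty n0%:R 0) => k.
  by rewrite mul0r addr0.
pose N := (Num.truncn (u k.+1)).+1.
have /andP[N1 N2] := truncn_itv (ltW (u_gt0 k.+1)).
have n0N : (n0 <= N)%N by rewrite -(ler_nat R); apply: (le_trans un0); exact: ltW.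
have /andP[_ H1] := hn0 N n0N.
have H2 : ((K k)%:R%:E <= Hlen (pts w) 0 (N%:R *: onev R d) N%:R)%E.
  apply: Hlen_ge; apply: chn_sub hc => o; rewrite ce_cub.
    by case: o => [i|] /=; rewrite ?mxE ltW.
  by case: o => [i|] /=; rewrite ?mxE ?mulr1 ltW.
have := le_lt_trans H2 H1; rewrite lte_fin => H3.
have := le_lt_trans (hK k) H3; apply/negP; rewrite -leNgt.
rewrite -uB.
have H4 : N%:R <= u k.+1 + 1 by rewrite /N -natr1 lerD2r.
apply: (@le_trans _ _ ((c + e / 4) * (u k.+1 + 1))).
  by rewrite ler_pM2l //; lra.
have H5 : (c + e) * u k <= e / 4 * u k.+1.
  rewrite uS mulrA ler_pM2r //.
  have : e * r <= e * b by rewrite ler_pM2l.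
  lra.
move: ub; rewrite ler_pdivrMr // => ub.
rewrite mulrBr; nra.
Unshelve. all: by end_near. Qed.

(** The first term is the threshold of the tail bound for a slab; adding k makes the probabilities
    summable. *)
Let S (k : nat) : nat := ((Num.truncn (2 * expR 1 * (u k.+1 / r))).+1 + k)%N.
(** Upper corner of the slab whose coordinate [o] stays below u_k. *)
Let sl o k : pt := mkpt (fun o' => if o' == o then u k else u k.+1).

Lemma slab_event o : {ae P, forall w, \forall k \near \oo,
  ~ chn (pts w) (cub 0) (sl o k) (S k)}.
Proof.
have [r2 a0 e0 rc rd] := hyps; have r_le_b := rb; have b1_gt0 := b1.
have v k : validbox (cub 0) (sl o k).
  split=> // o'; rewrite ce_cub ce_mkpt; case: ifP => _; exact: u_gt0.
have r0 : 0 < r by lra.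
apply: (@borel_cantelli1 (fun k => chain_event pts (cub 0) (sl o k) (S k)) 2).
  by move=> k; exact: (measurable_chain_event ppp).
have tail k : pr (chain_event pts (cub 0) (sl o k) (S k)) <= 2^-1 ^+ k.
  have s0 : 0 <= u k.+1 / r by rewrite divr_ge0 // ltW.
  apply: (@le_trans _ _ (2^-1 ^+ S k)).
    apply: (pr_chain_tail ppp (v k) s0).
      rewrite volE (bigD1 o) //= ce_cub ce_mkpt eqxx subr0.
      rewrite (eq_bigr (fun=> u k.+1)); last first.
        by move=> o' /negbTE h; rewrite ce_cub ce_mkpt h subr0.
      rewrite prodr_const.
      have -> : #|[pred o' : option 'I_d | o' != o]| = d.
        by have := cardC1 o; rewrite card_coords.
      rewrite expr_div_n -/b ler_pdivlMr ?exprn_gt0 //.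
      by rewrite mulrAC [u k * b]mulrC -uS -exprS.
    rewrite /S natrD; apply: (@le_trans _ _ (Num.truncn (2 * expR 1 * (u k.+1 / r))).+1%:R).
      exact/ltW/truncnS_gt.
    by rewrite lerDl.
  apply: ler_wiXn2l; rewrite ?leq_addl //; lra.
move=> n; apply: (@le_trans _ _ (\sum_(k < n) 2^-1 ^+ k)).
  by apply: ler_sum => k _; exact: tail.
elim: n => [|n IH]; first by rewrite big_ord0.
have -> : forall m, \sum_(k < m) (2^-1 : R) ^+ k = 2 - 2 * 2^-1 ^+ m.
  elim=> [|m IHm]; first by rewrite big_ord0 expr0; lra.
  by rewrite big_ord_recr /= IHm exprS; lra.
by rewrite gerBl mulr_ge0 // exprn_ge0.
Qed.

(** A longest chain of the cube at the origin splits into its part in the diagonal cube and its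
    parts in the d+1 slabs. The slab parts have total length at most (e/4) u_(k+1) + (d+1)(k+1), so
    the first part must be long. *)
Lemma cube_lower w (K : nat -> nat) : lim_at w ->
  (forall o, \forall k \near \oo, ~ chn (pts w) (cub 0) (sl o k) (S k)) ->
  (forall k, (K k)%:R <= Num.max 0 ((c - e) * (a * b ^+ k))) ->
  \forall k \near \oo, chn (pts w) (cub (u k)) (cub (u k.+1)) (K k).
Proof.
have [r2 a0 e0 rc rd] := hyps; have r_le_b := rb; have b1_gt0 := b1.
move=> hw hs hK; have c0 := lim_at_ge0 hw.
have e4 : 0 < e / 4 by lra.
have r0 : 0 < r by lra.
have [n0 _ hn0] := lim_at_bounds hw e4.
have hsn : \forall k \near \oo, forall o, ~ chn (pts w) (cub 0) (sl o k) (S k).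
  by apply: filter_forall => o; exact: hs.
near=> k.
have hsk : forall o, ~ chn (pts w) (cub 0) (sl o k) (S k) by near: k.
apply: contrapT => hG.
have K0 : (0 < K k)%N.
  by rewrite lt0n; apply/eqP => K0; apply: hG; rewrite K0; exists (fun=> 0); split.
have ce0 : 0 <= c - e.
  rewrite leNgt; apply/negP => ce0.
  have bk : 0 < b ^+ k by apply: exprn_gt0; lra.
  have := hK k; rewrite max_l; last by rewrite pmulr_lle0 ?(ltW ce0) // mulr_gt0.
  by rewrite lern0 -leqn0 leqNgt K0.
have ub : c * 2 / e + d.+1%:R * 2 / e * k.+1%:R <= u k.+1 by near: k; exact: u_infty.
have un0 : n0%:R + 1 <= u k.+1.
  near: k; apply: filterS (u_infty (n0%:R + 1) 0) => k.
  by rewrite mul0r addr0.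
pose N := Num.truncn (u k.+1).
have /andP[N1 N2] := truncn_itv (ltW (u_gt0 k.+1)).
have n0N : (n0 <= N)%N.
  rewrite -ltnS -(ltr_nat R); apply: le_lt_trans N2.
  by move: un0; lra.
have /andP[/Hlen_gt[l hl /chn_seqP[s [sz ss sb]]] _] := hn0 N n0N.
have sX : {in s, forall p, pts w p} by move=> p /sb[].
pose inG p := `[< box (cub (u k)) (cub (u k.+1)) p >].
pose inS o p := `[< box (cub 0) (sl o k) p >].
(* A point of the large cube outside the diagonal cube has some coordinate at most u_k. *)
have cover : {in s, forall p, inG p || [exists o, inS o p]}.
  move=> p /sb[_ /boxE pb].
  have pb' o : 0 < ce p o <= u k.+1.
    have /andP[h1 h2] := pb o; apply/andP; split.
      by apply: le_lt_trans h1; case: (o) => [i|] //=; rewrite mxE.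
    apply: (le_trans h2); apply: le_trans N1.
    by case: (o) => [i|] //=; rewrite !mxE mulr1.
  case: (boolP [forall o, u k < ce p o]) => [/forallP h|/forallPn[j hj]].
    apply/orP; left; apply/asboolP/boxE => o; rewrite !ce_cub h.
    by have /andP[] := pb' o.
  apply/orP; right; apply/existsP; exists j; apply/asboolP/boxE => o.
  have /andP[h1 h2] := pb' o; rewrite ce_cub ce_mkpt h1 /=.
  by case: eqP => [->|_] //; rewrite leNgt.
have := size_le_count cover; rewrite sz => hsz.
have cG : (count inG s <= K k)%N.
  rewrite leqNgt; apply/negP => h; apply: hG.
  by apply: (chn_leq (ltnW h)); exact: chn_count.
have cS o : (count (inS o) s <= S k)%N.
  rewrite leqNgt; apply/negP => h; apply: (hsk o).
  by apply: (chn_leq (ltnW h)); exact: chn_count.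
have hl2 : (l <= K k + d.+1 * S k)%N.
  apply: (leq_trans hsz); apply: leq_add => //.
  apply: (@leq_trans (\sum_(o : option 'I_d) S k)); first exact: leq_sum.
  by rewrite sum_nat_const card_coords.
have hl3 : l%:R <= (K k)%:R + d.+1%:R * (S k)%:R :> R by rewrite -natrM -natrD ler_nat.
have Sle : (S k)%:R <= 2 * expR 1 * (u k.+1 / r) + k.+1%:R.
  rewrite /S addSnnS natrD lerD2r truncn_le.
  apply: mulr_ge0; first by rewrite mulr_ge0 ?expR_ge0.
  by apply: divr_ge0; apply: ltW.
have Kle : (K k)%:R <= (c - e) * u k.+1.
  apply: (le_trans (hK k)); rewrite max_r; last first.
    by rewrite mulr_ge0 // mulr_ge0 ?(ltW a0) // exprn_ge0 //; have := rb; lra.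
  by rewrite -uB ler_wpM2l // gerBl ltW.
have rdu : d.+1%:R * (2 * expR 1 * (u k.+1 / r)) <= e / 4 * u k.+1.
  rewrite (_ : _ * _ = (d.+1%:R * (2 * expR 1) * u k.+1) / r); last by ring.
  rewrite ler_pdivrMr // [leRHS]mulrAC ler_pM2r //; lra.
have Sle2 : d.+1%:R * (S k)%:R <= e / 4 * u k.+1 + d.+1%:R * k.+1%:R.
  by rewrite (le_trans (ler_wpM2l _ Sle)) // mulrDr lerD2r.
have cN : (c - e / 4) * (u k.+1 - 1) <= (c - e / 4) * N%:R.
  rewrite ler_wpM2l //; first by lra.
  by rewrite lerBlDr natr1 ltW.
(* With u = u_(k+1), the bounds so far give (c - e/4)(u - 1) < (c - 3e/4) u + (d+1)(k+1), that is,
   (e/2) u < c - e/4 + (d+1)(k+1), which this inequality excludes. *)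
have ub2 : c * 2 + d.+1%:R * 2 * k.+1%:R <= u k.+1 * e.
  by move: ub; rewrite [_ / e * _]mulrAC -mulrDl ler_pdivrMr.
have := u_gt0 k.+1.
nra.
Unshelve. all: by end_near. Qed.

Hypothesis Hc : {ae P, forall w, lim_at w}.

Lemma box_upper (a' b' : nat -> pt) (K : nat -> nat) :
  (forall k, validbox (a' k) (b' k)) ->
  (forall k, vol (a' k) (b' k) = (a * b ^+ k) ^+ d.+1) ->
  (forall k, (c + e) * (a * b ^+ k) <= (K k)%:R) ->
  {ae P, forall w, \forall k \near \oo, ~ chn (pts w) (a' k) (b' k) (K k)}.
Proof.
move=> v vv hK.
have vv' k : vol (cub (u k)) (cub (u k.+1)) = vol (a' k) (b' k).
  by rewrite vv vol_cub uB.
have h := @chain_transfer _ _ _ _ K true G_valid v G_disj vv'.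
apply: filterS (h _) => [w|].
  by apply: filterS => k hk hc; apply: hk; split.
apply: filterS Hc => w hw; apply: filterS (cube_upper hw hK) => k hk [_ hc].
by apply: hk; exact: hc.
Qed.

Lemma box_lower (a' b' : nat -> pt) (K : nat -> nat) :
  (forall k, validbox (a' k) (b' k)) ->
  (forall k, vol (a' k) (b' k) = (a * b ^+ k) ^+ d.+1) ->
  (forall k, (K k)%:R <= Num.max 0 ((c - e) * (a * b ^+ k))) ->
  {ae P, forall w, \forall k \near \oo, chn (pts w) (a' k) (b' k) (K k)}.
Proof.
move=> v vv hK.
have vv' k : vol (cub (u k)) (cub (u k.+1)) = vol (a' k) (b' k).
  by rewrite vv vol_cub uB.
have h := @chain_transfer _ _ _ _ K false G_valid v G_disj vv'.
have slabs : {ae P, forall w, forall o, \forall k \near \oo,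
    ~ chn (pts w) (cub 0) (sl o k) (S k)}.
  by apply: filter_forall => o; exact: slab_event.
apply: filterS (h _) => [w|].
  by apply: filterS => k hk; apply: contrapT => hc; apply: hk; split.
apply: filterS2 Hc slabs => w hw hs.
by apply: filterS (cube_lower hw hs hK) => k hk [hc _]; have := hc hk.
Qed.

End Cubes.

Lemma exprn_ge_lin (x : R) n : 1 < x -> n%:R * (x - 1) <= x ^+ n.
Proof.
move=> x1; elim: n => [|n IH]; first by rewrite mul0r expr0.
have : 1 <= x ^+ n by apply: exprn_ege1; exact: ltW.
rewrite exprS -natr1; nra.
Qed.

Lemma near_exprn_ge (x z : R) : 1 < x -> \forall n \near \oo, z <= x ^+ n.
Proof.
move=> x1; near=> n; apply: le_trans (exprn_ge_lin n x1).
rewrite -ler_pdivrMr ?subr_gt0 //; near: n; exact: nbhs_infty_ger.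
Unshelve. all: by end_near. Qed.

Hypothesis Hc : {ae P, forall w, lim_at w}.

Lemma c_ge0 : 0 <= c.
Proof.
rewrite leNgt; apply/negP => c0; apply: ae_False.
by apply: filterS Hc => w /lim_at_ge0; rewrite leNgt c0.
Qed.

(** Side of the cube with the same volume as the space-time box of sides z and t. For z >= 0, c
    times it is t g(z/t). *)
Definition Gf (t : R) (z : V) : R := (t * \prod_i z ord0 i) `^ (d.+1%:R^-1).

Lemma Gf_pow (t : R) (z : V) : 0 <= t * \prod_i z ord0 i -> Gf t z ^+ d.+1 = t * \prod_i z ord0 i.
Proof.
by move=> h; rewrite /Gf -powR_mulrn ?powR_ge0 // -powRrM mulVf ?powRr1.
Qed.

(** The diagonal cubes need a large ratio b while [rho] is close to 1 in the applications. Hence the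
    exponents k are split into residue classes modulo j with rho^j = b, each class being one
    geometric sequence to which the transfer applies. *)
Lemma Hlen_lln (p q : V) (t rho eta : R) : vlt p q -> 0 < t -> 1 < rho -> 0 < eta ->
  {ae P, forall w, \forall k \near \oo,
     (((c * Gf t (q - p) - eta) * rho ^+ k)%:E <=
       Hlen (pts w) (rho ^+ k *: p) (rho ^+ k *: q) (rho ^+ k * t) <=
      ((c * Gf t (q - p) + eta) * rho ^+ k)%:E)%E}.
Proof.
move=> pq t0 rho1 eta0; set A := Gf t (q - p).
have prod0 : 0 < t * \prod_i (q - p) ord0 i.
  by apply: mulr_gt0 => //; apply: prodr_gt0 => i _; rewrite !mxE subr_gt0; exact: pq.
have A0 : 0 < A by exact: powR_gt0.
have c0 := c_ge0.
have rk k : 0 < rho ^+ k by apply: exprn_gt0; lra.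
(* Half of [eta] pays for the deviation; the other half pays for rounding the thresholds to
   integers. *)
pose e := eta / 2 / A.
have e0 : 0 < e by rewrite !divr_gt0.
have eA : e * A = eta / 2 by rewrite /e divfK // gt_eqF.
(* Size of [r] required in the cube estimates. *)
pose m := Num.max 2 (Num.max (4 * (c + e) / e) (4 * d.+1%:R * (2 * expR 1) / e)).
have [j' _ hj'] := near_exprn_ge m rho1.
have {hj'} := hj' j'.+1 (leqnSn j'); set r := rho ^+ j'.+1.
rewrite !ge_max !ler_pdivrMr // => /and3P[r2 rc rd].
pose j := (j'.+1 * d.+1)%N.
have bE : r ^+ d.+1 = rho ^+ j by rewrite -exprM.
pose QA k : pt := (rho ^+ k *: p, 0).
pose QB k : pt := (rho ^+ k *: q, rho ^+ k * t).
have Qv k : validbox (QA k) (QB k).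
  split=> // -[i|] /=; rewrite ?mxE ?ltr_pM2l ?mulr_gt0 //; exact: pq.
have Qvol k : vol (QA k) (QB k) = (A * rho ^+ k) ^+ d.+1.
  rewrite exprMn Gf_pow ?(ltW prod0) // volE big_option /= subr0.
  rewrite (eq_bigr (fun i => rho ^+ k * (q - p) ord0 i)); last first.
    by move=> i _; rewrite !mxE mulrBr.
  rewrite big_split /= prodr_const card_ord exprSr; ring.
pose KU k := (Num.truncn ((c + e) * (A * rho ^+ k))).+1.
pose KL k := Num.truncn (Num.max 0 ((c - e) * (A * rho ^+ k))).
have hyps i : [/\ 2 <= r, 0 < A * rho ^+ i, 0 < e, 4 * (c + e) <= e * r &
  4 * d.+1%:R * (2 * expR 1) <= e * r].
  by split=> //; [exact: mulr_gt0|rewrite [leRHS]mulrC..].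
have kE i l : A * rho ^+ i * (r ^+ d.+1) ^+ l = A * rho ^+ (j * l + i).
  by rewrite bE -exprM -mulrA -exprD addnC.
have U (i : 'I_j) : {ae P, forall w, \forall l \near \oo,
    ~ chn (pts w) (QA (j * l + i)%N) (QB (j * l + i)%N) (KU (j * l + i)%N)}.
  apply: (@box_upper _ _ _ (hyps i) Hc (fun l => QA (j * l + i)%N)
    (fun l => QB (j * l + i)%N) (fun l => KU (j * l + i)%N)) => l //.
    by rewrite Qvol kE.
  by rewrite kE; exact/ltW/truncnS_gt.
have L (i : 'I_j) : {ae P, forall w, \forall l \near \oo,
    chn (pts w) (QA (j * l + i)%N) (QB (j * l + i)%N) (KL (j * l + i)%N)}.
  apply: (@box_lower _ _ _ (hyps i) Hc (fun l => QA (j * l + i)%N)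
    (fun l => QB (j * l + i)%N) (fun l => KL (j * l + i)%N)) => l //.
    by rewrite Qvol kE.
  by rewrite kE truncn_le le_max lexx.
have {}U : {ae P, forall w, forall i : 'I_j, \forall l \near \oo,
    ~ chn (pts w) (QA (j * l + i)%N) (QB (j * l + i)%N) (KU (j * l + i)%N)}.
  by apply: filter_forall => i; exact: U.
have {}L : {ae P, forall w, forall i : 'I_j, \forall l \near \oo,
    chn (pts w) (QA (j * l + i)%N) (QB (j * l + i)%N) (KL (j * l + i)%N)}.
  by apply: filter_forall => i; exact: L.
apply: filterS2 U L => w Uw Lw.
have [M _ hM] : \forall l \near \oo, forall i : 'I_j,
    ~ chn (pts w) (QA (j * l + i)%N) (QB (j * l + i)%N) (KU (j * l + i)%N) /\
    chn (pts w) (QA (j * l + i)%N) (QB (j * l + i)%N) (KL (j * l + i)%N).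
  apply: filter_forall => i; apply: filterS2 (Uw i) (Lw i) => l; by split.
have j0 : (0 < j)%N by [].
near=> k.
have Mk : (M <= k %/ j)%N.
  by rewrite leq_divRL //; near: k; exact: nbhs_infty_ge.
(* From here on, a rounding error of 1 is at most (eta/2) rho^k. *)
have big : 2 / eta <= rho ^+ k by near: k; exact: near_exprn_ge.
have := hM (k %/ j)%N Mk (Ordinal (ltn_pmod k j0)).
rewrite /= mulnC -divn_eq => -[hU hL].
move: big; rewrite ler_pdivrMr // => big.
have x0 : 0 <= (c + e) * (A * rho ^+ k) by rewrite !mulr_ge0 ?addr_ge0 // ltW.
apply/andP; split.
  apply: le_trans (Hlen_ge hL); rewrite lee_fin /KL.
  have := truncnS_gt (Num.max 0 ((c - e) * (A * rho ^+ k))).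
  move: (Num.truncn _) => T; rewrite -natr1 gt_max => /andP[_] hlt.
  have e1 : (c - e) * (A * rho ^+ k) = (c * A - eta / 2) * rho ^+ k.
    by rewrite -eA; ring.
  rewrite e1 in hlt; lra.
apply: (le_trans (Hlen_le hU)); rewrite lee_fin /KU -natr1.
have : (Num.truncn ((c + e) * (A * rho ^+ k)))%:R <= (c + e) * (A * rho ^+ k).
  by rewrite truncn_le.
move: (Num.truncn _) => T.
have -> : (c + e) * (A * rho ^+ k) = (c * A + eta / 2) * rho ^+ k.
  by rewrite -eA; ring.
lra.
Unshelve. all: by end_near. Qed.

End LLN.

(** * Far boxes *)

Section FarField.
Variables (R : realType) (d : nat).
Local Notation V := 'rV[R]_d.
Local Notation pt := (V * R)%type.

Lemma coord_le_supnorm (y : V) i : `|y ord0 i| <= supnorm y.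
Proof. exact: (le_bigmax _ (fun i => `|y ord0 i|)). Qed.

Lemma supnorm_ge0 (y : V) : 0 <= supnorm y.
Proof. exact: bigmax_ge_id. Qed.

Lemma geometric_bracket (B x : R) : 1 < B -> 1 <= x ->
  exists i, x <= B ^+ i /\ B ^+ i <= B * x.
Proof.
move=> B1 x1.
have ex : exists i, x <= B ^+ i.
  by have [m _ hm] := near_exprn_ge x B1; exists m; apply: hm => /=.
case: (ex_minnP ex) => i hi mini; exists i; split=> //.
case: i hi mini => [|i] hi mini; first by rewrite expr0; nra.
rewrite exprS ler_pM2l; last by lra.
by rewrite ltW // ltNge; apply/negP => /mini; rewrite ltnn.
Qed.

(** Radii and times are (d+1)-st powers of dyadic numbers, so that the volume is a constant times
    the (d+1)-st power of 2^(jd+i). *)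
Definition far_lo (j : nat) : pt := (const_mx (- (2 ^+ j) ^+ d.+1), 0).
Definition far_hi (t : R) (i j : nat) : pt :=
  (const_mx ((2 ^+ j) ^+ d.+1), (2 ^+ i) ^+ d.+1 * t).

Lemma far_valid t i j : 0 < t -> validbox (far_lo j) (far_hi t i j).
Proof.
move=> t0; split=> // -[l|] /=; last by rewrite mulr_gt0 // !exprn_gt0.
by rewrite !mxE; apply: gtrN; rewrite !exprn_gt0.
Qed.

Lemma far_vol t i j : vol (far_lo j) (far_hi t i j) =
  2 ^+ d * t * (2 ^+ (j * d + i)) ^+ d.+1.
Proof.
rewrite volE big_option /= subr0.
rewrite (eq_bigr (fun=> 2 * (2 ^+ j) ^+ d.+1)); last first.
  by move=> l _; rewrite !mxE opprK mulr2n mulrDl mul1r.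
rewrite prodr_const card_ord exprMn exprD exprMn !exprM.
have -> : ((2 ^+ j) ^+ d.+1) ^+ d = ((2 ^+ j) ^+ d) ^+ d.+1 :> R by rewrite exprAC.
ring.
Qed.

Variables (dm : measure_display) (Om : measurableType dm)
  (P : probability Om R) (pts : Om -> set pt).
Hypothesis ppp : rate_one_poisson P pts.
Hypothesis d0 : (0 < d)%N.

(** The rank [i0] on the time scale serves all spatial scales [j], which is what a bound uniform in
    remote [y] requires. *)
Definition far_ok (t : R) (kap : nat) (w : Om) := exists i0, forall i j,
  (i0 <= i)%N -> ~ chn (pts w) (far_lo j) (far_hi t i j) (kap * 2 ^ (j * d + i)).

Lemma far_ok_ae (t : R) : 0 < t -> exists kap, {ae P, forall w, far_ok t kap w}.
Proof.
(* An integer at least 1 dominating the constant 2^d t, hence so does its (d+1)-st power. *)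
move=> t0; pose tau : R := (Num.truncn (2 ^+ d * t)).+1%:R.
have tau1 : 1 <= tau by rewrite ler1n.
have tauP : 2 ^+ d * t <= tau ^+ d.+1.
  by apply: (@le_trans _ _ tau); [exact/ltW/truncnS_gt|exact: ler_eXnr].
pose kap := (Num.truncn (2 * expR 1 * tau)).+1.
exists kap.
pose E i j := chain_event pts (far_lo j) (far_hi t i j) (kap * 2 ^ (j * d + i)).
have mE i j : measurable (E i j).
  by apply: (measurable_chain_event ppp); exact: far_valid.
have prE i j : pr P (E i j) <= 2^-1 ^+ (i + j).
  apply: (@le_trans _ _ (2^-1 ^+ (kap * 2 ^ (j * d + i)))).
    apply: (@pr_chain_tail _ _ _ _ _ _ ppp _ _ (tau * 2 ^+ (j * d + i))).
    - exact: far_valid.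
    - by rewrite mulr_ge0 ?exprn_ge0 // (le_trans _ tau1).
    - by rewrite far_vol [in leRHS]exprMn ler_pM2r // !exprn_gt0.
    - rewrite natrM natrX mulrA ler_pM2r ?exprn_gt0 //.
      exact/ltW/truncnS_gt.
  apply: ler_wiXn2l; [by lra|by lra|].
  apply: (@leq_trans (2 ^ (i + j))); first exact/ltnW/ltn_expl.
  apply: (@leq_trans (2 ^ (j * d + i))); last by rewrite leq_pmull.
  by rewrite leq_exp2l // addnC leq_add2r leq_pmulr.
(* The double family is grouped along i + j = n; the sum of (n+1) 2^(-n) is at most 4. *)
pose F n := [set w | exists2 i, i \in iota 0 n.+1 & E i (n - i)%N w].
have FP n := pr_has P (iota 0 n.+1) (fun i => mE i (n - i)%N).
have : {ae P, forall w, \forall n \near \oo, ~ F n w}.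
  apply: (@borel_cantelli1 _ _ _ _ F 4) => [n|n]; first exact: (FP n).1.
  apply: (@le_trans _ _ (\sum_(k < n) k.+1%:R * 2^-1 ^+ k)).
    apply: ler_sum => k _; apply: (le_trans (FP k).2).
    apply: (@le_trans _ _ (\sum_(i <- iota 0 k.+1) 2^-1 ^+ k)).
      rewrite big_seq [leRHS]big_seq; apply: ler_sum => i.
      rewrite mem_iota /= add0n ltnS => ik; apply: (le_trans (prE _ _)).
      by rewrite subnKC.
    by rewrite big_const_seq count_predT size_iota iter_addr addr0 mulr_natl.
  have -> : forall m, \sum_(k < m) k.+1%:R * (2^-1 : R) ^+ k =
      4 - (2 * m%:R + 4) * 2^-1 ^+ m.
    elim=> [|m IHm]; first by rewrite big_ord0 expr0; lra.
    by rewrite big_ord_recr /= IHm exprS -[m.+1%:R]natr1; field.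
  by rewrite gerBl mulr_ge0 ?exprn_ge0 // addr_ge0 // mulr_ge0.
apply: filterS => w [i0 _ hi0]; exists i0 => i j i0i hc.
apply: (hi0 (i + j)%N) => /=; first exact: leq_trans i0i (leq_addr _ _).
by exists i; rewrite ?mem_iota /= ?add0n ?ltnS ?leq_addr // addKn.
Qed.

(** With B = 2^(d+1), n and n|y| are bracketed by powers B^i and B^j. The threshold 2^(jd+i) equals
    (B^j)^(d/(d+1)) (B^i)^(1/(d+1)), hence is at most B n |y|^(d/(d+1)). *)
Lemma far_bound (t : R) kap w : 0 < t -> far_ok t kap w ->
  forall b : V, exists (M : R) (N : nat), forall n (x y : V), (N <= n)%N ->
    vle x b -> vle y x -> M <= supnorm y ->
    (Hlen (pts w) (n%:R *: y) (n%:R *: x) (n%:R * t) <=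
      (kap%:R * 2 ^+ d.+1 * n%:R * supnorm y `^ expo R d)%:E)%E.
Proof.
move=> t0 [i0 hi0] b; pose B : R := 2 ^+ d.+1.
have B1 : 1 < B by rewrite exprn_egt1 // ltr1n.
exists (Num.max 1 (supnorm b)), ((2 ^ d.+1) ^ i0)%N => n x y Nn xb yx.
rewrite ge_max => /andP[y1 yb].
have BiN : B ^+ i0 <= n%:R by rewrite /B -!natrX ler_nat.
have n1 : 1 <= n%:R :> R.
  by apply: le_trans BiN; apply: exprn_ege1; exact: ltW.
have ny1 : 1 <= n%:R * supnorm y by apply: mulr_ege1.
have [i [ni iB]] := geometric_bracket B1 n1.
have [j [nj jB]] := geometric_bracket B1 ny1.
have i0i : (i0 <= i)%N by rewrite -(ler_eXn2l B1) (le_trans BiN).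
have Bk k : B ^+ k = (2 ^+ k) ^+ d.+1 by rewrite exprAC.
have n0 : 0 <= n%:R :> R by [].
(* From y <= x <= b and |b| <= |y|, the coordinates of ny are at least -n|y| and those of nx at most
   n|y|, so the box lies in the far box. *)
have hn : ~ chn (pts w) (n%:R *: y, 0) (n%:R *: x, n%:R * t) (kap * 2 ^ (j * d + i)).
  move=> hc; apply: (hi0 i j i0i); apply: chn_sub hc => -[l|] //=; rewrite ?mxE -?Bk.
  - rewrite lerNl (le_trans _ nj) // -mulrN ler_wpM2l //.
    by apply: le_trans (coord_le_supnorm y l); rewrite -normrN ler_norm.
  - apply: le_trans nj; rewrite ler_wpM2l //; apply: le_trans yb.
    apply: le_trans (coord_le_supnorm b l); apply: le_trans (ler_norm _).
    exact: xb.
  - by rewrite ler_pM2r.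
apply: (le_trans (Hlen_le hn)); rewrite lee_fin natrM -!mulrA ler_wpM2l //.
have D0 : d.+1%:R != 0 :> R by rewrite pnatr_eq0.
pose e' : R := d.+1%:R^-1.
have ee' : expo R d + e' = 1.
  by apply: (mulIf D0); rewrite mulrDl divfK // mulVf // mul1r natr1.
have two0 k : 0 <= 2 ^+ k :> R by exact: exprn_ge0.
have p1 : (2 ^+ i : R) = (B ^+ i) `^ e'.
  by rewrite Bk -(powR_mulrn d.+1 (two0 i)) -powRrM mulfV // powRr1.
have p2 : (2 ^+ (j * d) : R) = (B ^+ j) `^ expo R d.
  rewrite Bk -(powR_mulrn d.+1 (two0 j)) -powRrM /expo mulrCA mulfV // mulr1.
  by rewrite powR_mulrn // -exprM.
have e0 : 0 <= e' by rewrite invr_ge0.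
have ex0 : 0 <= expo R d by rewrite divr_ge0.
have B0 : 0 <= B by lra.
have s0 : 0 <= supnorm y := supnorm_ge0 y.
rewrite natrX exprD p1 p2.
apply: (@le_trans _ _ ((B * (n%:R * supnorm y)) `^ expo R d * (B * n%:R) `^ e')).
  by apply: ler_pM; rewrite ?powR_ge0 //; apply: ge0_ler_powR;
     rewrite // nnegrE ?exprn_ge0 ?mulr_ge0.
rewrite [B * (n%:R * _)]mulrA powRM ?mulr_ge0 // mulrAC -powRD; last first.
  by rewrite ee' oner_eq0.
by rewrite ee' powRr1 ?mulr_ge0 // -mulrA.
Qed.

End FarField.

(** * Distances, roots and integer-valued suprema *)

Section Det.
Variables (R : realType) (d : nat).
Local Notation V := 'rV[R]_d.
Local Notation pt := (V * R)%type.

Definition vclose (e : R) (x y : V) := forall i, `|x ord0 i - y ord0 i| < e.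

Lemma vclose_ball e x y : 0 < e -> vclose e x y <-> ball x e y.
Proof.
move=> e0; split=> [h|[_ h] i]; last exact: h.
by split=> // i j; rewrite ord1; exact: h.
Qed.

Lemma nbhs_vclose (x : V) (A : set V) :
  nbhs x A <-> exists2 e : R, 0 < e & forall y, vclose e x y -> A y.
Proof.
split=> [/nbhs_ballP[e e0 h]|[e e0 h]].
  by exists e => // y /(vclose_ball _ _ e0); exact: h.
by apply/nbhs_ballP; exists e => // y /(vclose_ball _ _ e0); exact: h.
Qed.

Lemma vclose_sym e x y : vclose e x y -> vclose e y x.
Proof. by move=> h i; rewrite distrC. Qed.

Lemma vclose_trans e f x y z : vclose e x y -> vclose f y z -> vclose (e + f) x z.
Proof.
move=> h1 h2 i; apply: le_lt_trans (ler_distD (y ord0 i) _ _) _.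
exact: ltrD.
Qed.

Lemma vclose_le e f x y : e <= f -> vclose e x y -> vclose f x y.
Proof. by move=> ef h i; apply: lt_le_trans (h i) ef. Qed.

Lemma edist_ge (x y : V) i : `|x ord0 i - y ord0 i| <= Defs.edist x y.
Proof.
rewrite /Defs.edist -sqrtr_sqr ler_wsqrtr // (bigD1 i) //= lerDl.
by apply: sumr_ge0 => j _; exact: sqr_ge0.
Qed.

Lemma edist_lt_vclose (x y : V) e : Defs.edist x y < e -> vclose e x y.
Proof. by move=> h i; apply: le_lt_trans (edist_ge x y i) h. Qed.

(** The Euclidean distance is at most d times the largest coordinate difference; dividing by d+1
    gives a strict inequality and a nonzero denominator. *)
Lemma vclose_edist (x y : V) (e : R) : 0 < e -> vclose (e / d.+1%:R) x y -> Defs.edist x y < e.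
Proof.
move=> e0 h; set f := e / _ in h.
have f0 : 0 < f by rewrite divr_gt0.
have fe : f * d.+1%:R = e by rewrite divfK // pnatr_eq0.
move: f h f0 fe => f h f0 fe.
apply: (@le_lt_trans _ _ (f * d%:R)); last first.
  by rewrite -fe ltr_pM2l // ltr_nat.
have f1 : 0 <= f * d%:R by rewrite mulr_ge0 // ltW.
rewrite /Defs.edist -(ger0_norm f1) -sqrtr_sqr ler_wsqrtr //.
apply: (@le_trans _ _ (\sum_(i < d) f ^+ 2)).
  apply: ler_sum => i _; rewrite -real_normK ?num_real //.
  by rewrite lerXn2r ?nnegrE ?normr_ge0 ?(ltW f0) // (ltW (h i)).
rewrite sumr_const card_ord exprMn -[leLHS]mulr_natr ler_wpM2l ?sqr_ge0 //.
rewrite -natrX ler_nat -mulnn; nia.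
Qed.

Definition isrational (p : V) := exists q : 'rV[rat]_d, p = map_mx ratr q.

Lemma rational_between (lo hi : V) : vlt lo hi ->
  exists2 p, isrational p & vlt lo p /\ vlt p hi.
Proof.
move=> lh; have /choice[q hq] i : exists q : rat, lo ord0 i < ratr q < hi ord0 i.
  by have [q] := rat_in_itvoo (lh i); rewrite in_itv /= => h; exists q.
exists (map_mx ratr (\row_i q i)); first by exists (\row_i q i).
by split=> i; rewrite /Defs.coord !mxE; have /andP[] := hq i.
Qed.

(** Powers are superadditive on nonnegative numbers, hence roots are subadditive. *)
Lemma root_ge0_sub (v v' : R) : 0 <= v <= v' ->
  v' `^ d.+1%:R^-1 <= v `^ d.+1%:R^-1 + (v' - v) `^ d.+1%:R^-1.
Proof.
move=> /andP[v0 vv].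
have superadd n (x y : R) : 0 <= x -> 0 <= y -> x ^+ n.+1 + y ^+ n.+1 <= (x + y) ^+ n.+1.
  move=> x0 y0; elim: n => [|n IH]; first by rewrite !expr1.
  rewrite [leRHS]exprSr; apply: le_trans (ler_wpM2r (addr_ge0 x0 y0) IH).
  rewrite mulrDr !mulrDl -!exprSr.
  have := mulr_ge0 (exprn_ge0 n.+1 x0) y0; have := mulr_ge0 (exprn_ge0 n.+1 y0) x0; lra.
have rt (w : R) : 0 <= w -> (w `^ d.+1%:R^-1) ^+ d.+1 = w.
  by move=> w0; rewrite -powR_mulrn ?powR_ge0 // -powRrM mulVf ?powRr1.
rewrite -(@ler_pXn2r _ d.+1) ?nnegrE ?addr_ge0 ?powR_ge0 //.
apply: le_trans (superadd _ _ _ _ _); rewrite ?powR_ge0 //.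
by rewrite !rt ?subr_ge0 ?(le_trans v0 vv) // addrC subrK.
Qed.

(** A Hölder bound that stays uniform down to volume 0, where the root is not Lipschitz; boxes
    degenerate when x and y share a coordinate. *)
Lemma root_close (v v' e : R) : 0 <= v -> 0 <= v' -> 0 < e ->
  `|v - v'| < e ^+ d.+1 -> `|v `^ d.+1%:R^-1 - v' `^ d.+1%:R^-1| < e.
Proof.
wlog vv : v v' / v <= v' => [H|] v0 v'0 e0.
  have [vv|vv] := leP v v'; first exact: H.
  by rewrite distrC [X in X < e]distrC; apply: H => //; exact: ltW.
rewrite distrC ger0_norm ?subr_ge0 // => h.
have D0 : 0 <= (d.+1%:R^-1 : R) by rewrite invr_ge0.
rewrite distrC ger0_norm; last first.
  by rewrite subr_ge0; apply: ge0_ler_powR; rewrite ?nnegrE.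
have hsub := @root_ge0_sub v v' (introT andP (conj v0 vv)).
rewrite ltrBlDl; apply: le_lt_trans hsub _.
rewrite ltrD2l.
have -> : e = (e ^+ d.+1) `^ d.+1%:R^-1.
  by rewrite -powR_mulrn ?(ltW e0) // -powRrM mulfV ?powRr1 ?(ltW e0) // pnatr_eq0.
by apply: gt0_ltr_powR; rewrite ?nnegrE ?subr_ge0 ?invr_gt0 // exprn_ge0 // ltW.
Qed.

Lemma prod_continuous : continuous (fun z : V => \prod_i z ord0 i).
Proof.
apply: continuous_big => [x|i _]; first exact: mul_continuous.
exact: coord_continuous.
Qed.

Lemma Gf_close (t : R) (x y : V) (e : R) : 0 < t -> vle y x -> 0 < e ->
  exists2 f : R, 0 < f & forall p q, vclose f y p -> vclose f x q -> vle p q ->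
    `|Gf t (x - y) - Gf t (q - p)| < e.
Proof.
move=> t0 yx e0.
have nn (p q : V) : vle p q -> 0 <= t * \prod_i (q - p) ord0 i.
  move=> pq; apply: mulr_ge0; first exact: ltW.
  by apply: prodr_ge0 => i _; rewrite !mxE subr_ge0; exact: pq.
have /cvgrPdist_lt/(_ (e ^+ d.+1 / t)) := @prod_continuous (x - y).
rewrite divr_gt0 ?exprn_gt0 // => /(_ isT)/nbhs_vclose[f f0 hf].
exists (f / 2); first by lra.
move=> p q yp xq pq; apply: root_close => //; try exact: nn.
rewrite -mulrBr normrM gtr0_norm // mulrC -ltr_pdivlMr //.
apply: hf => i; rewrite !mxE.
have := yp i; have := xq i; move=> h1 h2.
rewrite (_ : _ - _ = (x ord0 i - q ord0 i) - (y ord0 i - p ord0 i)); last by ring.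
by apply: le_lt_trans (ler_normB _ _) _; lra.
Qed.

Definition isZ (v : \bar R) : Prop :=
  v = +oo%E \/ v = -oo%E \/ exists z : int, v = (z%:~R)%:E.

Lemma isZ_add a b : isZ a -> isZ b -> isZ (a + b)%E.
Proof.
move=> [->|[->|[z ->]]] [->|[->|[z' ->]]]; try by [left|right; left].
by right; right; exists (z + z'); rewrite -EFinD intrD.
Qed.

(** Take an integer element in (r-1, r]. If it were below r, some larger integer element would still
    be at most r, yet would exceed r. *)
Lemma isZ_sup_attained (S : set \bar R) (r : R) : (forall v, S v -> isZ v) ->
  ereal_sup S = r%:E -> S r%:E.
Proof.
move=> SZ supS.
have ub v : S v -> (v <= r%:E)%E by move=> Sv; rewrite -supS; exact: ereal_sup_ubound.
have pick (s : R) : s < r -> exists z : int, S (z%:~R)%:E /\ s < z%:~R <= r.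
  move=> sr; have /ereal_sup_gt[v Sv sv] : (s%:E < ereal_sup S)%E by rewrite supS lte_fin.
  have vr := ub _ Sv.
  have [vE|[vE|[z vE]]] := SZ _ Sv; rewrite vE in Sv sv vr => //.
  by exists z; split=> //; rewrite -!lee_fin -!lte_fin sv vr.
have [z [Sz /andP[z1 z2]]] := pick (r - 1) ltac:(lra).
have [zr|zr|<- //] := ltgtP z%:~R r; last by have := lt_le_trans zr z2; rewrite ltxx.
have [z' [_ /andP[z'1 z'2]]] := pick _ zr.
move: z'1; rewrite ltr_int -lezD1 -(ler_int R) intrD => h.
by have := le_trans h z'2; rewrite -lerBrDr leNgt z1.
Qed.

Lemma isZ_sup (S : set \bar R) : (forall v, S v -> isZ v) -> isZ (ereal_sup S).
Proof.
move=> SZ; case E : (ereal_sup S) => [r| |]; [|by left|by right; left].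
exact/SZ/(isZ_sup_attained SZ E).
Qed.

Lemma isZ_Hlen (X : set pt) (y x : V) t : isZ (Hlen X y x t).
Proof.
by apply: isZ_sup => _ [k _ <-]; right; right; exists k%:Z; rewrite pmulrn.
Qed.

(** * Two coupled height functions at one space-time point *)

Section Coupling.
Variables (X : set pt) (s0 z0 : V -> \bar R) (h : nat) (x : V) (T : R).
Hypothesis sZ : forall y, isZ (s0 y).
Hypothesis zZ : forall y, isZ (z0 y).
Hypothesis sz : forall y, (s0 y <= z0 y)%E /\ (z0 y <= s0 y + (h%:R)%:E)%E.
Variable r : R.
Hypothesis sr : evol X s0 x T = r%:E.
Local Notation H y := (Hlen X y x T).

Let s_le y : vle y x -> (s0 y + H y <= r%:E)%E.
Proof. by move=> yx; rewrite -sr; apply: ereal_sup_ubound; exists y. Qed.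

(** Finiteness at an optimal point makes cancellation of extended reals legitimate. *)
Let opt_fin y : vle y x -> (r%:E <= s0 y + H y)%E ->
  exists a b : R, [/\ s0 y = a%:E, H y = b%:E & a + b = r].
Proof.
move=> yx h1; have h2 := s_le yx; have := Hlen_ge0 X y x T; move: h1 h2.
case: (s0 y) => [a| |]; case: (H y) => [b| |] //=.
rewrite !lee_fin => h1 h2 _; exists a, b; split=> //.
by apply/eqP; rewrite eq_le h1 h2.
Qed.

(** Take an optimal starting point for [z0]. As [z0] exceeds [s0] by at most h there, a total of r +
    h forces the point to be optimal for [s0] and the excess to be exactly h. *)
Lemma coupling_eq : evol X z0 x T = (evol X s0 x T + (h%:R)%:E)%E ->
  exists y, [/\ vle y x, (s0 y + H y)%E = evol X s0 x T & z0 y = (s0 y + (h%:R)%:E)%E].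
Proof.
rewrite sr -EFinD => zr.
have [|y yx yE] := @isZ_sup_attained _ _ _ zr.
  by move=> _ [y _ <-]; apply: isZ_add => //; exact: isZ_Hlen.
have zy := (sz y).2.
have h1 : (r%:E <= s0 y + H y)%E.
  have : ((r + h%:R)%:E <= s0 y + H y + h%:R%:E)%E.
    by rewrite -yE addeAC; exact: leeD2r.
  by rewrite EFinD leeD2rE.
have [a [b [sa Hb ab]]] := opt_fin yx h1.
exists y; split=> //; first by rewrite sa Hb -ab.
move: yE; rewrite sa Hb => yE.
have -> : z0 y = ((r + h%:R) - b)%:E.
  by rewrite EFinB -yE addeK.
by rewrite -EFinD -ab; congr EFin; ring.
Qed.

(** Any optimal starting point for [s0] works: an excess of exactly h there would lift the value of
    [z0] to its maximum r + h. *)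
Lemma coupling_neq : evol X z0 x T <> (evol X s0 x T + (h%:R)%:E)%E ->
  exists y, [/\ vle y x, (s0 y + H y)%E = evol X s0 x T & z0 y <> (s0 y + (h%:R)%:E)%E].
Proof.
rewrite sr => ne.
have [|y yx yE] := @isZ_sup_attained _ _ _ sr.
  by move=> _ [y _ <-]; apply: isZ_add => //; exact: isZ_Hlen.
exists y; split=> // zy; apply: ne; apply/eqP; rewrite eq_le; apply/andP; split.
  apply: ge_ereal_sup => _ [y' y'x <-].
  apply: (@le_trans _ _ (s0 y' + H y' + h%:R%:E)%E).
    by rewrite addeAC; apply: leeD2r; exact: (sz y').2.
  by rewrite leeD2rE //; exact: s_le.
rewrite -yE addeAC -zy; apply: ereal_sup_ubound; by exists y.
Qed.

End Coupling.

End Det.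

(** * Chains at scale n, for a fixed outcome *)

Section Good.
Variables (R : realType) (d : nat).
Local Notation V := 'rV[R]_d.
Local Notation pt := (V * R)%type.

(** Cost of replacing the scale n by a nearby power of [rho m]. The sign of v is free, so the lemma
    serves lower corners through p and upper corners through -q. *)
Lemma scale_up (n s r v e : R) : 0 <= n <= s -> s <= (1 + r) * n -> r * `|v| <= e ->
  s * v <= n * (v + e).
Proof.
move=> /andP[n0 ns] sr rv.
have h1 : (s - n) * v <= (s - n) * `|v| by rewrite ler_wpM2l ?subr_ge0 // ler_norm.
have h2 : (s - n) * `|v| <= (r * n) * `|v| by rewrite ler_wpM2r //; lra.
have h3 : n * (r * `|v|) <= n * e by rewrite ler_wpM2l.
lra.
Qed.

Lemma scale_down (n s r v e : R) : 0 <= s <= n -> n <= (1 + r) * s -> 0 <= e ->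
  r * `|v| <= e -> n * (v - e) <= s * v.
Proof.
move=> /andP[s0 sn] nr e0 rv.
have h1 : (n - s) * v <= (n - s) * `|v| by rewrite ler_wpM2l ?subr_ge0 // ler_norm.
have h2 : (n - s) * `|v| <= (r * s) * `|v| by rewrite ler_wpM2r //; lra.
have h3 : s * (r * `|v|) <= s * e by rewrite ler_wpM2l.
have h4 : s * e <= n * e by rewrite ler_wpM2r.
lra.
Qed.

(** Countably many ratios that tend to 1. *)
Definition rho (m : nat) : R := 1 + m.+1%:R^-1.

Lemma rho_gt1 m : 1 < rho m.
Proof. by rewrite ltrDl invr_gt0. Qed.

Lemma exists_rho (w e : R) : 0 < e -> exists m : nat, m.+1%:R^-1 * w <= e.
Proof.
move=> e0; exists (Num.truncn (w / e)).
rewrite mulrC ler_pdivrMr // mulrC -ler_pdivrMr //; exact/ltW/truncnS_gt.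
Qed.

Lemma rho_bracket m k0 : exists N, forall n, (N <= n)%N -> exists k,
  [/\ (k0 <= k)%N, rho m ^+ k <= n%:R & n%:R <= rho m ^+ k.+1].
Proof.
have r1 := rho_gt1 m.
exists (Num.truncn (rho m ^+ k0.+1)).+1 => n Nn.
have nk : rho m ^+ k0.+1 < n%:R.
  by apply: lt_le_trans (truncnS_gt _) _; rewrite ler_nat.
have n1 : 1 <= n%:R :> R.
  by apply/ltW/(le_lt_trans _ nk); apply: exprn_ege1; exact: ltW.
have [i [ni iB]] := geometric_bracket r1 n1.
have : (k0.+1 < i)%N by rewrite -(ltr_eXn2l r1) (lt_le_trans nk).
case: i ni iB => // i ni; rewrite exprS ler_pM2l; last by lra.
by move=> iB; rewrite ltnS => ki; exists i; split=> //; exact: ltnW.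
Qed.

Variables (X : set pt) (c t : R) (u0 : V -> R) (sg : nat -> V -> \bar R).
(** The facts about one outcome from which the deterministic argument runs. Limits are recorded only
    at rational points and along powers of [rho m], so that countably many almost sure events
    suffice. *)
Record good : Prop := Good {
  good_d : (0 < d)%N;
  good_c : 0 <= c;
  good_t : 0 < t;
  good_u : u0_hyp u0;
  good_lln : forall p q : V, isrational p -> isrational q -> vlt p q ->
    forall m (eta : R), 0 < eta -> \forall k \near \oo,
     (((c * Gf t (q - p) - eta) * rho m ^+ k)%:E <=
       Hlen X (rho m ^+ k *: p) (rho m ^+ k *: q) (rho m ^+ k * t) <=
      ((c * Gf t (q - p) + eta) * rho m ^+ k)%:E)%E;
  good_mono : forall n x y, vle x y -> (sg n x <= sg n y)%E;
  good_Z : forall n x, isZ (sg n x);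
  good_lim : forall p, isrational p ->
    (fun n : nat => (sg n (n%:R *: p) * (n%:R^-1)%:E)%E) @ \oo --> (u0 p)%:E;
  good_tail : forall (b : V) (C : R), 0 < C -> exists (M : R) (N : nat),
    forall n y, (N <= n)%N -> vle y b -> M <= supnorm y ->
    (sg n (n%:R *: y) <= (- C * n%:R * supnorm y `^ expo R d)%:E)%E;
  good_far : exists2 C : R, 0 <= C & forall b : V, exists (M : R) (N : nat),
    forall n (x y : V), (N <= n)%N -> vle x b -> vle y x -> M <= supnorm y ->
    (Hlen X (n%:R *: y) (n%:R *: x) (n%:R * t) <=
      (C * n%:R * supnorm y `^ expo R d)%:E)%E }.

Hypothesis G : good.

Local Notation Hn n y x := (Hlen X (n%:R *: y) (n%:R *: x) (n%:R * t)).

Lemma vle_scale (n : nat) (x y : V) : vle x y -> vle (n%:R *: x) (n%:R *: y).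
Proof. by move=> h i; rewrite /Defs.coord !mxE ler_wpM2l //; exact: h. Qed.

Lemma u0_close (x : V) (e : R) : 0 < e ->
  exists2 f : R, 0 < f & forall y, vclose f x y -> `|u0 x - u0 y| < e.
Proof.
move=> e0; have [_ [/(_ x)[r [r0 [L hL]]] _]] := good_u G.
have L1 : 0 < `|L| + 1 by apply: ltr_wpDl.
exists (Num.min r (e / (`|L| + 1))); first by rewrite lt_min r0 divr_gt0.
move=> y /vclose_ball; rewrite lt_min r0 divr_gt0 // => /(_ isT).
rewrite -ball_normE /= lt_min => /andP[h1 h2].
have := hL x y; rewrite subrr normr0 r0 => /(_ isT).
rewrite [X in X < r]distrC => /(_ h1) h3.
apply: (le_lt_trans h3).
apply: (@le_lt_trans _ _ (`|L| * `|x - y|)); first by rewrite ler_wpM2r // ler_norm.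
apply: (@le_lt_trans _ _ ((`|L| + 1) * `|x - y|)); first by rewrite ler_wpM2r // lerDl.
by rewrite mulrC -ltr_pdivlMr.
Qed.

Lemma sg_bounds (p : V) (e : R) : isrational p -> 0 < e -> \forall n \near \oo,
  ((n%:R * (u0 p - e))%:E <= sg n (n%:R *: p) <= (n%:R * (u0 p + e))%:E)%E.
Proof.
move=> /(good_lim G)/fine_cvgP[fin_near hfine] e0; near=> n.
have n0 : 0 < n%:R :> R by near: n; exact: nbhs_infty_gtr.
have fin : (sg n (n%:R *: p) * (n%:R^-1)%:E)%E \is a fin_num.
  by near: n; exact: fin_near.
rewrite ![n%:R * _]mulrC !EFinM -lee_pdivrMr // -lee_pdivlMr // -(fineK fin) !lee_fin.
apply/andP; split; near: n.
  by apply: (cvgr_ge _ hfine); lra.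
by apply: (cvgr_le _ hfine); lra.
Unshelve. all: by end_near. Qed.

Lemma cGf_close (x y : V) (e : R) : vle y x -> 0 < e ->
  exists2 f : R, 0 < f & forall p q, vclose f y p -> vclose f x q -> vle p q ->
    `|c * Gf t (x - y) - c * Gf t (q - p)| < e.
Proof.
have c0 := good_c G; move=> yx e0.
have c1 : 0 < c + 1 by lra.
have [|f f0 hf] := @Gf_close _ _ t x y (e / (c + 1)) (good_t G) yx; first exact: divr_gt0.
exists f => // p q h1 h2 h3; have := hf p q h1 h2 h3.
rewrite ltr_pdivlMr // => h4; rewrite -mulrBr normrM (ger0_norm c0).
by apply: le_lt_trans h4; rewrite mulrC ler_wpM2l // lerDl.
Qed.

Let shift (x : V) (e : R) : V := \row_i (x ord0 i + e).

Lemma rational_near (x : V) (a b : R) : a < b ->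
  exists2 p, isrational p & forall i, x ord0 i + a < p ord0 i < x ord0 i + b.
Proof.
move=> ab; have [|p rp [h1 h2]] := @rational_between _ _ (shift x a) (shift x b).
  by move=> i; rewrite /Defs.coord !mxE ltrD2l.
by exists p => // i; have := h1 i; have := h2 i; rewrite /Defs.coord !mxE => -> ->.
Qed.

(** The boxes at scale n with corners near y0 and x0 all lie in one slightly larger rational box
    dilated by the power of [rho m] just above n. *)
Lemma Hn_upper (x0 y0 : V) (e : R) : vle y0 x0 -> 0 < e ->
  exists2 f : R, 0 < f & exists N, forall n (x y : V), (N <= n)%N ->
    vclose f x0 x -> vclose f y0 y ->
    (Hn n y x <= (n%:R * (c * Gf t (x0 - y0) + e))%:E)%E.
Proof.
move=> yx e0; have e4 : 0 < e / 4 by lra.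
have [f1 f10 hf1] := cGf_close yx e4.
have [p rp hp] := @rational_near y0 (- f1) (- (f1 / 2)) ltac:(lra).
have [q rq hq] := @rational_near x0 (f1 / 2) f1 ltac:(lra).
have pq : vlt p q.
  move=> i; have /andP[_ h1] := hp i; have /andP[h2 _] := hq i.
  by have h3 := yx i; rewrite /Defs.coord in h3 *; lra.
have {}hf1 : `|c * Gf t (x0 - y0) - c * Gf t (q - p)| < e / 4.
  apply: hf1 => i; last exact: ltW.
    by have /andP[h1 h2] := hp i; rewrite ltr_norml; lra.
  by have /andP[h1 h2] := hq i; rewrite ltr_norml; lra.
pose v := c * Gf t (q - p) + e / 4.
(* With this ratio, passing from n to a power of [rho m] moves p and q by less than the margin f1/4
   and the value by at most e/4, per unit of n. *)
have [m hm] := @exists_rho (supnorm p + supnorm q + `|v|) (Num.min (f1 / 4) (e / 4))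
   ltac:(rewrite lt_min; lra).
move: hm; rewrite le_min => /andP[hm1 hm2].
have [[sp0 sq0] v0] := (supnorm_ge0 p, supnorm_ge0 q, normr_ge0 v).
have im0 : 0 <= m.+1%:R^-1 :> R by rewrite invr_ge0.
have bnd (w : R) e' : w <= supnorm p + supnorm q + `|v| ->
    m.+1%:R^-1 * (supnorm p + supnorm q + `|v|) <= e' -> m.+1%:R^-1 * w <= e'.
  by move=> h1 h2; apply: le_trans h2; rewrite ler_wpM2l.
have [k0 _ hk0] := good_lln G rp rq pq m e4.
have [N hN] := rho_bracket m k0.
exists (f1 / 4); first by lra.
exists N => n x y Nn cx cy.
have [k [k0k kn nk]] := hN n Nn.
set s := rho m ^+ k.+1 in nk.
have ns : (0 : R) <= n%:R <= s by rewrite ler0n nk.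
have sn : s <= (1 + m.+1%:R^-1) * n%:R.
  by rewrite /s exprS ler_pM2l //; have := rho_gt1 m; lra.
have /andP[_ Hs] := hk0 k.+1 (leq_trans k0k (leqnSn k)).
apply: (@le_trans _ _ (Hlen X (s *: p) (s *: q) (s * t))).
  apply: Hlen_mono.
  - move=> i; rewrite /Defs.coord !mxE.
    have h := @scale_up _ _ _ (p ord0 i) (f1 / 4) ns sn.
    apply: le_trans (h _) _.
      by apply: (bnd _ _ _ hm1); have := coord_le_supnorm p i; lra.
    rewrite ler_wpM2l //; have /andP[_ h1] := hp i.
    by have := cy i; rewrite ltr_norml => /andP[h2 h3]; lra.
  - move=> i; rewrite /Defs.coord !mxE.
    have h := @scale_up _ _ _ (- q ord0 i) (f1 / 4) ns sn.
    rewrite -lerN2 -mulrN; apply: le_trans (h _) _.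
      by rewrite normrN; apply: (bnd _ _ _ hm1); have := coord_le_supnorm q i; lra.
    rewrite -mulrN ler_wpM2l //; have /andP[h1 _] := hq i.
    by have := cx i; rewrite ltr_norml => /andP[h2 h3]; lra.
  - by rewrite ler_wpM2r // ltW // (good_t G).
apply: (le_trans Hs); rewrite lee_fin -/v mulrC.
apply: le_trans (@scale_up _ _ _ v (e / 4) ns sn _) _.
  by apply: (bnd _ _ _ hm2); lra.
rewrite ler_wpM2l // /v.
by move: hf1 e4; clear; rewrite ltr_norml => /andP[h1 h2] e4; lra.
Qed.

(** The starting point is a fixed rational point slightly below y1, where the limit of the initial
    heights is known; it serves every x near x0. Its boxes contain a dilated smaller rational
    box. *)
Lemma Hn_lower (x0 y1 : V) (e : R) : vle y1 x0 -> 0 < e ->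
  exists p, [/\ isrational p, u0 y1 - e < u0 p & exists2 f : R, 0 < f &
    exists N, forall n (x : V), (N <= n)%N -> vclose f x0 x ->
      vle p x /\ ((n%:R * (c * Gf t (x0 - y1) - e))%:E <= Hn n p x)%E].
Proof.
move=> yx e0; have e4 : 0 < e / 4 by lra.
have [f1 f10 hf1] := cGf_close yx e4.
have [f2 f20 hf2] := u0_close y1 e0.
pose f3 := Num.min f1 f2.
have f30 : 0 < f3 by rewrite lt_min f10.
have f31 : f3 <= f1 by rewrite ge_min lexx.
have f32 : f3 <= f2 by rewrite ge_min lexx orbT.
(* [p1] is the starting point; the smaller box runs from [p] to [q], and the space between [p1] and
   [p] absorbs the change of scale. *)
have [p1 rp1 hp1] := @rational_near y1 (- f3) (- (3 * f3 / 4)) ltac:(lra).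
have [p rp hp] := @rational_near y1 (- (f3 / 2)) (- (f3 / 4)) ltac:(lra).
have [q rq hq] := @rational_near x0 (- (f3 / 4)) (- (f3 / 8)) ltac:(lra).
have pq : vlt p q.
  move=> i; have /andP[_ h1] := hp i; have /andP[h2 _] := hq i.
  by have h3 := yx i; rewrite /Defs.coord in h3 *; lra.
have {}hf1 : `|c * Gf t (x0 - y1) - c * Gf t (q - p)| < e / 4.
  apply: hf1 => i; last exact: ltW.
    by have /andP[h1 h2] := hp i; rewrite ltr_norml; lra.
  by have /andP[h1 h2] := hq i; rewrite ltr_norml; lra.
exists p1; split=> //.
  have /hf2 : vclose f2 y1 p1.
    by move=> i; have /andP[h1 h2] := hp1 i; rewrite ltr_norml; lra.
  by rewrite ltr_norml => /andP[_ h]; lra.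
pose v := c * Gf t (q - p) - e / 4.
have [m hm] := @exists_rho (supnorm p + supnorm q + `|v|) (Num.min (f3 / 16) (e / 4))
   ltac:(rewrite lt_min; lra).
move: hm; rewrite le_min => /andP[hm1 hm2].
have [[sp0 sq0] v0] := (supnorm_ge0 p, supnorm_ge0 q, normr_ge0 v).
have im0 : 0 <= m.+1%:R^-1 :> R by rewrite invr_ge0.
have bnd (w : R) e' : w <= supnorm p + supnorm q + `|v| ->
    m.+1%:R^-1 * (supnorm p + supnorm q + `|v|) <= e' -> m.+1%:R^-1 * w <= e'.
  by move=> h1 h2; apply: le_trans h2; rewrite ler_wpM2l.
have [k0 _ hk0] := good_lln G rp rq pq m e4.
have [N hN] := rho_bracket m k0.
exists (f3 / 16); first by lra.
exists N => n x Nn cx; split.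
  move=> i; have /andP[_ h1] := hp1 i; have h3 := yx i.
  have := cx i; rewrite ltr_norml => /andP[h4 h5]; rewrite /Defs.coord in h3 *; lra.
have [k [k0k kn nk]] := hN n Nn.
set s := rho m ^+ k in kn.
have s0 : 0 < s by apply: exprn_gt0; have := rho_gt1 m; lra.
have ns : 0 <= s <= n%:R by rewrite (ltW s0) kn.
have sn : n%:R <= (1 + m.+1%:R^-1) * s by move: nk; rewrite exprS.
have /andP[Hs _] := hk0 k k0k.
have f160 : 0 <= f3 / 16 by lra.
apply: (@le_trans _ _ (Hlen X (s *: p) (s *: q) (s * t))); last first.
  apply: Hlen_mono.
  - move=> i; rewrite /Defs.coord !mxE.
    have h := @scale_down _ _ _ (p ord0 i) (f3 / 16) ns sn f160.
    apply: le_trans (h _); last first.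
      by apply: (bnd _ _ _ hm1); have := coord_le_supnorm p i; lra.
    by rewrite ler_wpM2l //; have /andP[h1 _] := hp i; have /andP[_ h2] := hp1 i; lra.
  - move=> i; rewrite /Defs.coord !mxE.
    have h := @scale_down _ _ _ (- q ord0 i) (f3 / 16) ns sn f160.
    rewrite -lerN2 -[- (s * _)]mulrN; apply: le_trans (h _); last first.
      by rewrite normrN; apply: (bnd _ _ _ hm1); have := coord_le_supnorm q i; lra.
    rewrite -mulrN ler_wpM2l //; have /andP[_ h1] := hq i.
    by have := cx i; rewrite ltr_norml => /andP[h2 h3]; lra.
  - by rewrite ler_wpM2r // ltW // (good_t G).
apply: le_trans Hs; rewrite lee_fin -/v [leRHS]mulrC.
apply: le_trans (@scale_down _ _ _ v (e / 4) ns sn (ltW e4) _); last first.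
  by apply: (bnd _ _ _ hm2); lra.
rewrite ler_wpM2l // /v.
by move: hf1 e4; clear; rewrite ltr_norml => /andP[h1 h2] e4; lra.
Qed.

End Good.

(** * Optimal starting points and their limits *)

Section Optimizers.
Variables (R : realType) (d : nat).
Local Notation V := 'rV[R]_d.
Local Notation pt := (V * R)%type.
Variables (X : set pt) (c t : R) (u0 : V -> R) (sg : nat -> V -> \bar R).
Hypothesis G : good X c t u0 sg.
Local Notation Hn n y x := (Hlen X (n%:R *: y) (n%:R *: x) (n%:R * t)).
Local Notation ev n x := (evol X (sg n) (n%:R *: x) (n%:R * t)).

(** Homogeneity: t moves under the root as t^(d+1), and t^(d+1) t^(-d) = t. *)
Lemma gfun_scaled (x y : V) : vle y x ->
  (t%:E * gfun c (t^-1 *: (x - y)))%E = (c * Gf t (x - y))%:E.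
Proof.
have t0 := good_t G; have D0 : d.+1%:R != 0 :> R by rewrite pnatr_eq0.
move=> yx; rewrite /gfun asboolT; last first.
  move=> i; rewrite /Defs.coord !mxE mulr_ge0 ?invr_ge0 ?(ltW t0) // subr_ge0.
  exact: yx.
rewrite -EFinM; congr EFin; rewrite mulrCA; congr (_ * _).
have P0 : 0 <= \prod_(i < d) (x - y) ord0 i.
  by apply: prodr_ge0 => i _; rewrite !mxE subr_ge0; exact: yx.
under eq_bigr do rewrite /Defs.coord mxE.
rewrite big_split /= prodr_const card_ord /Gf.
have {1}-> : t = (t ^+ d.+1) `^ d.+1%:R^-1.
  by rewrite -powR_mulrn ?(ltW t0) // -powRrM mulfV // powRr1 // ltW.
rewrite -powRM ?mulr_ge0 ?exprn_ge0 ?invr_ge0 ?(ltW t0) //; congr (_ `^ _).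
by rewrite mulrA exprS exprVn mulfK // expf_neq0 // gt_eqF.
Qed.

Lemma Wpt_neg (x y : V) : vle y x -> ~ Wpt c u0 y t x ->
  exists2 y1, vle y1 x & u0 y + c * Gf t (x - y) < u0 y1 + c * Gf t (x - y1).
Proof.
move=> yx nW; have le : ((u0 y + c * Gf t (x - y))%:E <= ufun c u0 x t)%E.
  by rewrite EFinD -gfun_scaled //; apply: ereal_sup_ubound; exists y.
have : ((u0 y + c * Gf t (x - y))%:E < ufun c u0 x t)%E.
  rewrite lt_neqAle le andbT; apply/eqP => h; apply: nW; split=> //.
  by rewrite gfun_scaled // -EFinD.
move=> /ereal_sup_gt[_ [y1 y1x <-]]; rewrite gfun_scaled // -EFinD lte_fin => h.
by exists y1.
Qed.

Lemma ev_ge n (x y : V) : vle y x -> (sg n (n%:R *: y) + Hn n y x <= ev n x)%E.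
Proof.
move=> yx; apply: ereal_sup_ubound; exists (n%:R *: y) => //.
exact: vle_scale.
Qed.

(** Either y0 <= x0 fails and no nearby pair is ordered, or some y1 does strictly better, and this
    macroscopic gap survives at scale n. Monotonicity bounds the heights near y0 by the height at a
    rational point above. *)
Lemma not_optimal (x0 y0 : V) : ~ Wpt c u0 y0 t x0 ->
  exists2 f : R, 0 < f & exists N, forall n (x y : V), (N <= n)%N ->
    vclose f x0 x -> vclose f y0 y -> vle y x ->
    (sg n (n%:R *: y) + Hn n y x < ev n x)%E.
Proof.
move=> nW; have [yx|nyx] := pselect (vle y0 x0); last first.
  have [i hi] : exists i, ~ (y0 ord0 i <= x0 ord0 i).
    by apply: contrapT => h; apply: nyx => i; apply: contrapT => hi; apply: h; exists i.
  move/negP: hi; rewrite -ltNge => hi.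
  exists ((y0 ord0 i - x0 ord0 i) / 2); first by lra.
  exists 0%N => n x y _ cx cy yx; exfalso.
  have h1 := yx i; have := cx i; have := cy i; rewrite /Defs.coord in h1.
  rewrite !ltr_norml => /andP[h2 h3] /andP[h4 h5]; lra.
have [y1 y1x gap] := Wpt_neg yx nW.
(* Each of the two sides loses 3e in the approximations, leaving 2e of the gap 8e. *)
pose e := (u0 y1 + c * Gf t (x0 - y1) - (u0 y0 + c * Gf t (x0 - y0))) / 8.
have e0 : 0 < e by rewrite /e; lra.
have [p [rp up [fa fa0 [Na hNa]]]] := Hn_lower G y1x e0.
have [Nb _ hNb] := sg_bounds G rp e0.
have [fb fb0 [Nc hNc]] := Hn_upper G yx e0.
have [fc fc0 hfc] := u0_close G y0 e0.
have [q rq hq] := @rational_near _ _ y0 (fc / 2) fc ltac:(lra).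
have [Nd _ hNd] := sg_bounds G rq e0.
have uq : u0 q < u0 y0 + e.
  have /hfc : vclose fc y0 q.
    by move=> i; have /andP[h1 h2] := hq i; rewrite ltr_norml; lra.
  by rewrite ltr_norml => /andP[h _]; lra.
exists (Num.min fa (Num.min fb (fc / 2))).
  by rewrite !lt_min fa0 fb0 divr_gt0.
exists (maxn 1 (maxn (maxn Na Nb) (maxn Nc Nd))) => n x y.
rewrite !geq_max => /and3P[n1 /andP[nNa nNb] /andP[nNc nNd]] cx cy _.
have cxa : vclose fa x0 x by apply: vclose_le cx; rewrite ge_min lexx.
have cxb : vclose fb x0 x by apply: vclose_le cx; rewrite !ge_min lexx orbT.
have cyb : vclose fb y0 y by apply: vclose_le cy; rewrite !ge_min lexx orbT.
have cyc : vclose (fc / 2) y0 y by apply: vclose_le cy; rewrite !ge_min lexx !orbT.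
have [px Hp] := hNa n x nNa cxa.
have /andP[sp _] := hNb n nNb.
have Hy := hNc n x y nNc cxb cyb.
have /andP[_ sq] := hNd n nNd.
have yq : vle y q.
  move=> i; have := cyc i; rewrite ltr_norml => /andP[h1 h2].
  by have /andP[h3 h4] := hq i; rewrite /Defs.coord; lra.
have sy := le_trans (good_mono G n (vle_scale n yq)) sq.
apply: (le_lt_trans (leeD sy Hy)); apply: lt_le_trans (ev_ge n px).
apply: lt_le_trans (leeD sp Hp); rewrite -!EFinD lte_fin -!mulrDr.
have n0 : 0 < n%:R :> R by rewrite ltr0n.
rewrite ltr_pM2l //; move: up uq gap; rewrite /e; clear; lra.
Qed.

(** For remote y the decay of the initial heights beats the growth of chain lengths, both of order n
    |y|^(d/(d+1)). The remaining y have a common upper bound, so the supremum is finite. *)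
Lemma ev_tail (x0 : V) : exists2 f : R, 0 < f & exists (M : R) N,
  forall n (x : V), (N <= n)%N -> vclose f x0 x ->
    (exists r : R, ev n x = r%:E) /\
    forall y, vle y x -> M <= supnorm y -> (sg n (n%:R *: y) + Hn n y x < ev n x)%E.
Proof.
pose b : V := \row_i (x0 ord0 i + 1).
have [C C0 /(_ b)[Mf [Nf hf]]] := good_far G.
have [|Ms [Ns hs]] := @good_tail _ _ _ _ _ _ _ G b (C + 1); first by lra.
have [p rp hp] := @rational_near _ _ x0 (-1) (- 2^-1) ltac:(lra).
have [q rq hq] := @rational_near _ _ x0 1 2 ltac:(lra).
have [Np _ hNp] := sg_bounds G rp ltr01.
have [Nq _ hNq] := sg_bounds G rq ltr01.
have ex0 : 0 < expo R d by rewrite divr_gt0 // ltr0n (good_d G).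
(* Decay constant C+1 against growth constant C leaves -n |y|^(d/(d+1)), which is below the lower
   bound n (u0 p - 1) once the power of |y| reaches K. *)
pose K := `|u0 p| + 2; have K0 : 0 <= K by rewrite addr_ge0.
pose M := Num.max (Num.max Mf Ms) (K `^ (expo R d)^-1).
have M0 : 0 <= M by rewrite le_max powR_ge0 orbT.
exists 2^-1; first by lra.
exists M, (maxn 1 (maxn (maxn Nf Ns) (maxn Np Nq))) => n x.
rewrite !geq_max => /and3P[n1 /andP[nNf nNs] /andP[nNp nNq]] cx.
have n0 : 0 < n%:R :> R by rewrite ltr0n.
have px : vle p x.
  move=> i; have := cx i; rewrite ltr_norml => /andP[h1 h2].
  by have /andP[h3 h4] := hp i; rewrite /Defs.coord; lra.
have xb : vle x b.
  move=> i; have := cx i; rewrite ltr_norml => /andP[h1 h2].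
  by rewrite /Defs.coord !mxE; lra.
have xq : vle x q.
  move=> i; have := cx i; rewrite ltr_norml => /andP[h1 h2].
  by have /andP[h3 h4] := hq i; rewrite /Defs.coord; lra.
have /andP[sp _] := hNp n nNp.
have /andP[_ sq] := hNq n nNq.
have xx : vle x x by [].
have lo : ((n%:R * (u0 p - 1))%:E <= ev n x)%E.
  apply: le_trans (ev_ge n xx); apply: (le_trans sp).
  apply: (le_trans (good_mono G n (vle_scale n px))).
  by apply: leeDl; exact: Hlen_ge0.
have tail y : vle y x -> M <= supnorm y ->
    (sg n (n%:R *: y) + Hn n y x < (n%:R * (u0 p - 1))%:E)%E.
  move=> yx; rewrite !ge_max => /andP[/andP[yf ys] yK].
  have yb : vle y b by move=> i; apply: le_trans (yx i) (xb i).
  apply: (le_lt_trans (leeD (hs n y nNs yb ys) (hf n x y nNf xb yx yf))).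
  rewrite -EFinD lte_fin.
  have Ks : K <= supnorm y `^ expo R d.
    rewrite -[K](@powRr1 _ K) // -(@mulVf _ (expo R d)) ?gt_eqF // powRrM.
    by apply: ge0_ler_powR; rewrite ?nnegrE ?powR_ge0 ?supnorm_ge0 ?(ltW ex0).
  have up : - `|u0 p| <= u0 p by rewrite lerNl -normrN ler_norm.
  have h1 : n%:R * (- supnorm y `^ expo R d) < n%:R * (u0 p - 1).
    by rewrite ltr_pM2l //; move: Ks; rewrite /K; lra.
  apply: le_lt_trans h1; lra.
split; last by move=> y yx yM; apply: lt_le_trans (tail y yx yM) lo.
have [i0] : exists i : 'I_d, True by exists (Ordinal (good_d G)).
(* This corner lies below every y with |y| < M and is itself remote, so the far bound controls the
   chains from all these y. *)
pose y' : V := const_mx (- M).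
have sy' : M <= supnorm y'.
  by apply: le_trans (coord_le_supnorm y' i0); rewrite mxE normrN ler_norm.
have fin y : vle y x -> (sg n (n%:R *: y) + Hn n y x <=
    (Num.max (n%:R * (u0 p - 1))
      (n%:R * (u0 q + 1) + C * n%:R * supnorm y' `^ expo R d))%:E)%E.
  move=> yx; have [yM|yM] := leP M (supnorm y).
    apply: (le_trans (ltW (tail y yx yM))).
    by rewrite lee_fin le_max lexx.
  have y'y : vle y' y.
    move=> i; rewrite /Defs.coord mxE lerNl.
    apply: (le_trans _ (ltW yM)); apply: le_trans (coord_le_supnorm y i).
    by rewrite -normrN ler_norm.
  have y'x : vle y' x by move=> i; apply: le_trans (y'y i) (yx i).
  have yq : vle y q by move=> i; apply: le_trans (yx i) (xq i).
  apply: (@le_trans _ _ (n%:R * (u0 q + 1) + C * n%:R * supnorm y' `^ expo R d)%:E); last first.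
    by rewrite lee_fin le_max lexx orbT.
  rewrite EFinD; apply: leeD.
    exact: le_trans (good_mono G n (vle_scale n yq)) sq.
  apply: (@le_trans _ _ (Hn n y' x)); first by apply: Hlen_mono => //; exact: vle_scale.
  apply: hf => //; apply: le_trans sy'.
  by rewrite /M !le_max lexx.
have hi : (ev n x <= (Num.max (n%:R * (u0 p - 1))
      (n%:R * (u0 q + 1) + C * n%:R * supnorm y' `^ expo R d))%:E)%E.
  apply: ge_ereal_sup => _ [z zx <-].
  have zE : z = n%:R *: (n%:R^-1 *: z).
    by rewrite scalerA mulfV ?scale1r // gt_eqF.
  rewrite zE; apply: fin => i; rewrite /Defs.coord mxE.
  rewrite mulrC ler_pdivrMr //; have := zx i; rewrite /Defs.coord mxE.
  by rewrite mulrC.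
move: lo hi; case: (ev n x) => [r| |] //= _ _; by exists r.
Qed.

(* The optimal starting points of [sg n] near [x0] stay in a compact set and accumulate
   only at points [y] with [x0] in [W(y, t)]. *)
Lemma optimizers_avoid (Q : nat -> set V) (x0 : V) :
  (forall y, Wpt c u0 y t x0 -> exists2 f : R, 0 < f & exists N, forall n y',
     (N <= n)%N -> vclose f y y' -> ~ Q n y') ->
  exists2 f : R, 0 < f & exists N, forall n (x : V), (N <= n)%N -> vclose f x0 x ->
    (exists r : R, ev n x = r%:E) /\
    forall y, vle y x -> (sg n (n%:R *: y) + Hn n y x)%E = ev n x -> ~ Q n y.
Proof.
move=> hQ; have [f1 f10 [M [N1 h1]]] := ev_tail x0.
pose K : set V := [set y | forall i, `[- `|M|, `|M|]%classic (y ord0 i)].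
have cK : compact K.
  apply: (@rV_compact R d (fun=> `[- `|M|, `|M|]%classic)) => i.
  exact: segment_compact.
pose Pr (nx : nat * V) (y : V) := vle y nx.2 ->
  (sg nx.1 (nx.1%:R *: y) + Hn nx.1 y nx.2)%E = ev nx.1 nx.2 -> ~ Q nx.1 y.
(* For y with x0 in W(y, t) the hypothesis on [Q] applies; any other y is not optimal even after
   perturbation. Compactness of K then gives one neighbourhood of x0 and one rank. *)
have : forall y, K y -> \forall y' \near y & i \near filter_prod \oo (nbhs x0), Pr i y'.
  move=> y _.
  have : exists2 f : R, 0 < f & exists N, forall n x y', (N <= n)%N ->
      vclose f x0 x -> vclose f y y' -> Pr (n, x) y'.
    have [W|nW] := pselect (Wpt c u0 y t x0).
      have [f f0 [N hN]] := hQ y W; exists f => //; exists N => n x y' nN cx cy _ _.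
      exact: hN cy.
    have [f f0 [N hN]] := not_optimal nW; exists f => //; exists N => n x y' nN cx cy yx.
    by have := hN n x y' nN cx cy yx => /[swap] /= ->; rewrite ltxx.
  move=> [f f0 [N hN]].
  exists (ball y f, [set nx : nat * V | (N <= nx.1)%N /\ ball x0 f nx.2]) => /=.
    split; first exact: nbhsx_ballx.
    exists ([set n | (N <= n)%N], ball x0 f) => /=.
      by split; [exact: nbhs_infty_ge|exact: nbhsx_ballx].
    by move=> [n x] /= [].
  move=> [y' [n x]] /= [/(vclose_ball _ _ f0) cy [nN /(vclose_ball _ _ f0) cx]].
  exact: hN.
move=> /(proj1 (compact_near_coveringP K) cK _ _ _ _)[[A B]].
move=> /= [[N2 _ hN2] /nbhs_vclose[f2 f20 hf2]] hAB.
exists (Num.min f1 f2); first by rewrite lt_min f10.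
exists (maxn N1 N2) => n x; rewrite geq_max => /andP[nN1 nN2] cx.
have cx1 : vclose f1 x0 x by apply: vclose_le cx; rewrite ge_min lexx.
have cx2 : vclose f2 x0 x by apply: vclose_le cx; rewrite ge_min lexx orbT.
have [fin tail] := h1 n x nN1 cx1; split=> // y yx opt.
have [yM|yM] := leP M (supnorm y).
  by have := tail y yx yM; rewrite opt ltxx.
have Ky : K y.
  move=> i /=; rewrite in_itv /= -ler_norml.
  by apply: le_trans (coord_le_supnorm y i) _; apply: le_trans (ltW yM) (ler_norm _).
have /(_ y Ky yx opt) := hAB (n, x) (conj (hN2 n nN2) (hf2 x cx2)).
by [].
Qed.

End Optimizers.

(** * Coupled height functions *)

Section Coupled.
Variables (R : realType) (d : nat).
Local Notation V := 'rV[R]_d.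
Local Notation pt := (V * R)%type.

(** Compactness in its near-covering form turns a rank that depends on x0 into one rank for all of
    K. *)
Lemma compact_eventually (K : set V) (Q : nat -> V -> Prop) : compact K ->
  (forall x0, K x0 -> exists2 f : R, 0 < f & exists N, forall n (x : V), (N <= n)%N ->
    vclose f x0 x -> Q n x) ->
  exists N, forall n, (N <= n)%N -> forall x, K x -> Q n x.
Proof.
move=> cK h.
have : forall x, K x -> \forall x' \near x & n \near \oo, Q n x'.
  move=> x /h[f f0 [N hN]].
  exists (ball x f, [set n | (N <= n)%N]) => /=.
    by split; [exact: nbhsx_ballx|exact: nbhs_infty_ge].
  by move=> [y n] /= [/(vclose_ball _ _ f0) cy nN]; exact: hN.
by move=> /(proj1 (compact_near_coveringP K) cK _ _ _ _)[N _ hN]; exists N.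
Qed.

Lemma compact_vbox (y : V) (f : R) :
  compact [set y' : V | forall i, `[y ord0 i - f, y ord0 i + f]%classic (y' ord0 i)].
Proof.
apply: (@rV_compact R d (fun i => `[y ord0 i - f, y ord0 i + f]%classic)) => i.
exact: segment_compact.
Qed.

Lemma vclose_vbox (y y' : V) (f : R) : vclose f y y' ->
  forall i, `[y ord0 i - f, y ord0 i + f]%classic (y' ord0 i).
Proof.
by move=> h i; rewrite /= in_itv /=; have := h i; rewrite ltr_norml => /andP[h1 h2]; lra.
Qed.

Variables (X : set pt) (c t : R) (u0 : V -> R) (sg zt : nat -> V -> \bar R)
  (h : nat) (B : set V).
Hypothesis G : good X c t u0 sg.
Hypothesis ztZ : forall n x, isZ (zt n x).
Hypothesis sz : forall n y, (sg n y <= zt n y)%E /\ (zt n y <= sg n y + (h%:R)%:E)%E.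
Hypothesis cB : closed B.
Hypothesis A0 : forall K : set V, compact K -> forall e : R, 0 < e ->
  exists N : nat, forall n, (N <= n)%N ->
    let A0 := [set x | zt n x = (sg n x + (h%:R)%:E)%E] in
    nbhd_minus B e `&` K `<=` invscale n A0 `&` K /\
    invscale n A0 `&` K `<=` nbhd_plus B e `&` K.

Definition coupled_set n (s : R) := [set x : V |
  evol X (zt n) x s = (evol X (sg n) x s + (h%:R)%:E)%E].
Local Notation An n := (invscale n (coupled_set n (n%:R * t))).

Let unscale (n : nat) (x y : V) : (0 < n)%N -> vle y (n%:R *: x) ->
  y = n%:R *: (n%:R^-1 *: y) /\ vle (n%:R^-1 *: y) x.
Proof.
move=> n0 yx; have n0' : 0 < n%:R :> R by rewrite ltr0n.
split; first by rewrite scalerA mulfV ?scale1r // gt_eqF.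
move=> i; have := yx i; rewrite /Defs.coord !mxE => h1.
by rewrite mulrC ler_pdivrMr // mulrC.
Qed.

(** Every macroscopic optimizer for x0 lies in the open complement of B, near which the upper
    inclusion excludes [A_n(0)]. Membership of x would require an optimal starting point in
    [A_n(0)], by [coupling_eq]. *)
Lemma not_Wset_near (x0 : V) : ~ Wset c u0 B t x0 ->
  exists2 f : R, 0 < f & exists N, forall n (x : V), (N <= n)%N -> vclose f x0 x ->
    ~ An n x.
Proof.
move=> nW.
have [|f f0 [N hN]] := @optimizers_avoid _ _ _ _ _ _ _ G
  (fun n y => zt n (n%:R *: y) = (sg n (n%:R *: y) + (h%:R)%:E)%E) x0.
  move=> y Wy.
  have nBy : ~ B y by move=> By; apply: nW; exists y.
  have : nbhs y (~` B) by apply: open_nbhs_nbhs; split=> //; exact: closed_openC.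
  move=> /nbhs_vclose[g g0 hg].
  have g2 : 0 < g / 2 by lra.
  have [N hN] := A0 (@compact_vbox y (g / 2)) g2.
  exists (g / 2) => //; exists N => n y' nN cy' Qy.
  have [_ /(_ y')] := hN n nN; case; first by split=> //; exact: vclose_vbox.
  move=> [z [Bz /edist_lt_vclose cz]] _; apply: (hg z) => //.
  by apply: vclose_le (vclose_trans cy' cz); lra.
exists f => //; exists (maxn 1 N) => n x; rewrite geq_max => /andP[n1 nN] cx.
have [[r rE] noQ] := hN n x nN cx.
move=> /(coupling_eq (ztZ n) (sz n) rE)[y [yx opt zy]].
have [yE y'x] := unscale n1 yx.
by apply: (noQ _ y'x); rewrite -yE.
Qed.

(** Dual case: every macroscopic optimizer is interior to B, near which the lower inclusion puts all
    points in [A_n(0)]; [coupling_neq] concludes. *)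
Lemma not_Wset_compl_near (x0 : V) : ~ Wset c u0 (closure (~` B)) t x0 ->
  exists2 f : R, 0 < f & exists N, forall n (x : V), (N <= n)%N -> vclose f x0 x ->
    An n x.
Proof.
move=> nW.
have [|f f0 [N hN]] := @optimizers_avoid _ _ _ _ _ _ _ G
  (fun n y => zt n (n%:R *: y) <> (sg n (n%:R *: y) + (h%:R)%:E)%E) x0.
  move=> y Wy.
  have nBy : ~ closure (~` B) y by move=> By; apply: nW; exists y.
  have : nbhs y B.
    apply: contrapT => nb; apply: nBy => U yU; apply: contrapT => nU; apply: nb.
    by apply: filterS yU => z Uz; apply: contrapT => nBz; apply: nU; exists z.
  move=> /nbhs_vclose[g g0 hg].
  have g2 : 0 < g / 2 by lra.
  have [N hN] := A0 (@compact_vbox y (g / 2)) g2.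
  exists (g / 2) => //; exists N => n y' nN cy'; apply.
  have [/(_ y') + _] := hN n nN; case=> //; split; last exact: vclose_vbox.
  split; first by apply: hg; apply: vclose_le cy'; lra.
  move=> z nBz; rewrite leNgt; apply/negP => /edist_lt_vclose cz; apply: nBz.
  by apply: hg; apply: vclose_le (vclose_trans cy' cz); lra.
exists f => //; exists (maxn 1 N) => n x; rewrite geq_max => /andP[n1 nN] cx.
have [[r rE] noQ] := hN n x nN cx.
apply: contrapT => /(coupling_neq (good_Z G n) (sz n) rE)[y [yx opt zy]].
have [yE y'x] := unscale n1 yx.
by apply: (noQ _ y'x); rewrite -yE.
Qed.

Lemma coupled_empty (K : set V) : Wset c u0 B t = set0 -> compact K ->
  exists N, forall n, (N <= n)%N -> coupled_set n (n%:R * t) `&` Defs.scale n K = set0.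
Proof.
move=> W0 cK; have [x0 _|N hN] := @compact_eventually K (fun n x => ~ An n x) cK.
  by apply: not_Wset_near; rewrite W0.
exists N => n nN; apply/seteqP; split=> // z [h1 [k Kk kE]].
by apply: (hN n nN k Kk); rewrite /invscale /= kE.
Qed.

(** Off X(B, t) the rescaled set is locally empty or locally everything for large n, hence has no
    boundary there. *)
Lemma coupled_boundary (K : set V) (e : R) : compact K -> 0 < e ->
  exists N, forall n, (N <= n)%N ->
    Defs.bd (An n) `&` K `<=` nbhd_plus (Xset c u0 B t) e `&` K.
Proof.
move=> cK e0.
have [x0 _|N hN] := @compact_eventually K
    (fun n x => Defs.bd (An n) x -> nbhd_plus (Xset c u0 B t) e x) cK.
  have [W1|nW1] := pselect (Wset c u0 B t x0); last first.
    have [f f0 [N hN]] := not_Wset_near nW1.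
    exists (f / 2); first by lra.
    exists N => n x nN cx [clA _]; exfalso.
    have /clA[z [Az /(vclose_ball _ _ _) cz]] : nbhs x (ball x (f / 2)).
      by apply: nbhsx_ballx; lra.
    apply: (hN n z nN) => //.
    by apply: vclose_le (vclose_trans cx (cz _)); lra.
  have [W2|nW2] := pselect (Wset c u0 (closure (~` B)) t x0); last first.
    have [f f0 [N hN]] := not_Wset_compl_near nW2.
    exists (f / 2); first by lra.
    exists N => n x nN cx [_ clA]; exfalso.
    have /clA[z [Az /(vclose_ball _ _ _) cz]] : nbhs x (ball x (f / 2)).
      by apply: nbhsx_ballx; lra.
    apply: Az; apply: (hN n z nN).
    by apply: vclose_le (vclose_trans cx (cz _)); lra.
  exists (e / d.+1%:R); first exact: divr_gt0.
  exists 0%N => n x _ cx _; exists x0; split=> //.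
  by apply: vclose_edist => //; exact: vclose_sym.
by exists N => n nN x [bx Kx]; split=> //; exact: (hN n nN x Kx bx).
Qed.

(** The added hypothesis settles the points x0 of W(closure of the complement of B, t) in the lower
    inclusion: none is interior to W(B, t), so no point close to x0 lies in the e-shrunken set. *)
Lemma coupled_shape (K : set V) (e : R) : compact K -> 0 < e ->
  (forall x, Wset c u0 (closure (~` B)) t x -> ~ (interior (Wset c u0 B t)) x) ->
  exists N, forall n, (N <= n)%N ->
    nbhd_minus (Wset c u0 B t) e `&` K `<=` An n `&` K /\
    An n `&` K `<=` nbhd_plus (Wset c u0 B t) e `&` K.
Proof.
move=> cK e0 hint.
have [x0 _|N1 hN1] := @compact_eventually K
    (fun n x => nbhd_minus (Wset c u0 B t) e x -> An n x) cK.
  have [W2|nW2] := pselect (Wset c u0 (closure (~` B)) t x0); last first.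
    have [f f0 [N hN]] := not_Wset_compl_near nW2.
    by exists f => //; exists N => n x nN cx _; exact: hN.
  (* A point within f of x0 that had Euclidean distance at least e to the complement of W(B, t)
     would make x0 interior. *)
  have [f f0 f2] : exists2 f : R, 0 < f & f + f = e / d.+1%:R.
    by exists (e / d.+1%:R / 2); [rewrite !divr_gt0|rewrite -splitr].
  exists f; first exact: f0.
  exists 0%N => n x _ cx [_ far]; exfalso; apply: (hint _ W2).
  have near_x0 : nbhs x0 (Wset c u0 B t).
    apply: (proj2 (nbhs_vclose _ _)); exists f; first exact: f0.
    move=> z cz; apply: contrapT => nWz.
    have cxz : vclose (e / d.+1%:R) x z.
      by rewrite -f2; exact: vclose_trans (vclose_sym cx) cz.
    by have := lt_le_trans (vclose_edist e0 cxz) (far z nWz); rewrite ltxx.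
  exact: near_x0.
have [x0 _|N2 hN2] := @compact_eventually K
    (fun n x => An n x -> nbhd_plus (Wset c u0 B t) e x) cK.
  have [W1|nW1] := pselect (Wset c u0 B t x0); last first.
    have [f f0 [N hN]] := not_Wset_near nW1.
    by exists f => //; exists N => n x nN cx /(hN n x nN cx).
  exists (e / d.+1%:R); first exact: divr_gt0.
  exists 0%N => n x _ cx _; exists x0; split=> //.
  by apply: vclose_edist => //; exact: vclose_sym.
exists (maxn N1 N2) => n; rewrite geq_max => /andP[n1 n2].
by split=> x [bx Kx]; split=> //; [exact: (hN1 n n1 x Kx bx)|exact: (hN2 n n2 x Kx bx)].
Qed.

End Coupled.

(** * Almost sure validity of the facts about one outcome *)

Section AlmostSure.
Variables (R : realType) (d : nat) (dm : measure_display) (Om : measurableType dm)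
  (P : probability Om R).
Local Notation V := 'rV[R]_d.

Lemma ae_forall_count (T : countType) (Q : T -> Om -> Prop) :
  (forall x, {ae P, forall w, Q x w}) -> {ae P, forall w, forall x, Q x w}.
Proof.
move=> h.
have : {ae P, forall w, forall n, if unpickle n is Some x then Q x w else True}.
  apply: ae_foralln => n; case: (unpickle n) => [x|]; first exact: h.
  exact: aeW.
by apply: filterS => w hw x; have := hw (pickle x); rewrite pickleK.
Qed.

Variables (pts : Om -> set (V * R)) (c t : R) (u0 : V -> R)
  (sg : nat -> Om -> V -> \bar R).

(** All real parameters are first restricted to countable families: rational corners, tolerances
    1/(j+1), integer bounds and constants. Monotonicity in these parameters gives back the general
    statements. *)
Lemma good_ae : (2 <= d)%N -> rate_one_poisson P pts ->
  {ae P, forall w, (fun n : nat => (Hlen (pts w) 0 (n%:R *: onev R d) n%:R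
                                    * (n%:R^-1)%:E)%E) @ \oo --> c%:E} ->
  u0_hyp u0 -> (forall n w, in_Sigma (sg n w)) ->
  (forall y : V, {ae P, forall w, (fun n : nat =>
       (sg n w (n%:R *: y) * (n%:R^-1)%:E)%E) @ \oo --> (u0 y)%:E}) ->
  (forall (b : V) (C : R), 0 < C -> {ae P, forall w, exists (M : R) (N : nat),
       forall n y, (N <= n)%N -> vle y b -> M <= supnorm y ->
       (sg n w (n%:R *: y) <= (- C * n%:R * supnorm y `^ expo R d)%:E)%E}) ->
  0 < t -> {ae P, forall w, good (pts w) c t u0 (fun n => sg n w)}.
Proof.
move=> d2 ppp Hc hu hS hlim htail t0.
have d0 : (0 < d)%N by exact: ltnW.
have c0 := c_ge0 Hc.
have [kap Hfar] := far_ok_ae ppp d0 t0.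
have Hlln : {ae P, forall w, forall z : 'rV[rat]_d * 'rV[rat]_d * nat * nat,
    let p : V := map_mx ratr z.1.1.1 in let q : V := map_mx ratr z.1.1.2 in
    let m := z.1.2 in let eta : R := z.2.+1%:R^-1 in
    vlt p q -> \forall k \near \oo,
     (((c * Gf t (q - p) - eta) * rho R m ^+ k)%:E <=
       Hlen (pts w) (rho R m ^+ k *: p) (rho R m ^+ k *: q) (rho R m ^+ k * t) <=
      ((c * Gf t (q - p) + eta) * rho R m ^+ k)%:E)%E}.
  apply: ae_forall_count => -[[[p q] m] j] /=.
  have [pq|npq] := pselect (vlt (map_mx ratr p : V) (map_mx ratr q)); last first.
    by apply: aeW => w /npq.
  have j0 : 0 < j.+1%:R^-1 :> R by rewrite invr_gt0.
  by apply: filterS (Hlen_lln ppp d0 Hc pq t0 (rho_gt1 R m) j0) => w hw _.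
have Hlim : {ae P, forall w, forall q : 'rV[rat]_d, (fun n : nat =>
    (sg n w (n%:R *: (map_mx ratr q : V)) * (n%:R^-1)%:E)%E) @ \oo --> (u0 (map_mx ratr q))%:E}.
  by apply: ae_forall_count => q; exact: hlim.
have Htail : {ae P, forall w, forall z : nat * nat, exists (M : R) (N : nat),
    forall n y, (N <= n)%N -> vle y (const_mx z.1%:R) -> M <= supnorm y ->
    (sg n w (n%:R *: y) <= (- z.2.+1%:R * n%:R * supnorm y `^ expo R d)%:E)%E}.
  by apply: ae_forall_count => z; apply: htail; rewrite ltr0n.
apply: filterS2 Hfar (filterI Hlln (filterI Hlim Htail)) => w far [lln [lim tail]].
split=> //.
- move=> _ _ [p ->] [q ->] pq m eta eta0.
  have [j hj] := exists_rho 1 eta0; rewrite mulr1 in hj.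
  apply: filterS (lln (p, q, m, j) pq) => k /andP[/= h1 h2].
  have rk : 0 <= rho R m ^+ k by apply: exprn_ge0; have := rho_gt1 R m; lra.
  apply/andP; split.
    by apply: le_trans h1; rewrite lee_fin ler_wpM2r // lerD2l lerN2.
  by apply: (le_trans h2); rewrite lee_fin ler_wpM2r // lerD2l.
- by move=> n x y; have [_ [+ _]] := hS n w; apply.
- by move=> n x; have [+ _] := hS n w; apply.
- by move=> _ [q ->]; exact: lim.
- move=> b C C0.
  (* Integers dominating b in every coordinate and C. *)
  have [M [N hN]] := tail ((Num.truncn (supnorm b)).+1, Num.truncn C).
  exists M, N => n y nN yb yM; apply: (le_trans (hN n y nN _ yM)).
    move=> i; rewrite /Defs.coord mxE; apply: (le_trans (yb i)).
    apply: (le_trans (ler_norm _)); apply: (le_trans (coord_le_supnorm b i)).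
    exact/ltW/truncnS_gt.
  rewrite lee_fin !mulNr lerN2 ler_wpM2r ?powR_ge0 // ler_wpM2r //.
  exact/ltW/truncnS_gt.
- exists (kap%:R * 2 ^+ d.+1); first by rewrite mulr_ge0 // exprn_ge0.
  exact: far_bound.
Qed.

End AlmostSure.

Theorem theorem5p1 (R : realType) (d : nat) (hd : (2 <= d)%N)
  (dm : measure_display) (Om : measurableType dm) (P : probability Om R)
  (pts : Om -> set ('rV[R]_d * R))
  (c : R) (u0 : 'rV[R]_d -> R)
  (sigma0 zeta0 : nat -> Om -> 'rV[R]_d -> \bar R)
  (h : nat) (B : set 'rV[R]_d) (t : R) :
  rate_one_poisson P pts ->
  (* c = c_{d+1}: a.s. limit of n^{-1} x (maximal chain length in (0, n1]^{d+1}) *)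
  {ae P, forall w, (fun n : nat => (Hlen (pts w) 0 (n%:R *: onev R d) n%:R
                                    * (n%:R^-1)%:E)%E) @ \oo --> c%:E} ->
  u0_hyp u0 ->
  (forall n w, in_Sigma (sigma0 n w)) ->
  (forall y : 'rV[R]_d, {ae P, forall w, (fun n : nat =>
       (sigma0 n w (n%:R *: y) * (n%:R^-1)%:E)%E) @ \oo --> (u0 y)%:E}) ->
  (forall (b : 'rV[R]_d) (C : R), 0 < C -> {ae P, forall w, exists (M : R) (N : nat),
       forall n y, (N <= n)%N -> vle y b -> M <= supnorm y ->
       (sigma0 n w (n%:R *: y) <= (- C * n%:R * supnorm y `^ expo R d)%:E)%E}) ->
  (0 < h)%N -> closed B -> 0 < t ->
  (forall n w, in_Sigma (zeta0 n w)) ->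
  (forall n w y, (sigma0 n w y <= zeta0 n w y)%E /\
                 (zeta0 n w y <= sigma0 n w y + (h%:R)%:E)%E) ->
  (* A_n(0) *)
  {ae P, forall w, forall K : set 'rV[R]_d, compact K -> forall e : R, 0 < e ->
     exists N : nat, forall n, (N <= n)%N ->
       let A0 := [set x | zeta0 n w x = (sigma0 n w x + (h%:R)%:E)%E] in
       nbhd_minus B e `&` K `<=` invscale n A0 `&` K /\
       invscale n A0 `&` K `<=` nbhd_plus B e `&` K} ->
  let An := fun (n : nat) (w : Om) (s : R) =>
    [set x | evol (pts w) (zeta0 n w) x s = (evol (pts w) (sigma0 n w) x s + (h%:R)%:E)%E] in
  let WB := Wset c u0 B t in
  [/\ (WB = set0 ->
        {ae P, forall w, forall K : set 'rV[R]_d, compact K ->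
           exists N : nat, forall n, (N <= n)%N ->
             An n w (n%:R * t) `&` scale n K = set0}),
      (WB !=set0 ->
        {ae P, forall w, forall K : set 'rV[R]_d, compact K -> forall e : R, 0 < e ->
           exists N : nat, forall n, (N <= n)%N ->
             bd (invscale n (An n w (n%:R * t))) `&` K
               `<=` nbhd_plus (Xset c u0 B t) e `&` K})
    & (WB !=set0 ->
       (forall x, Wset c u0 (closure (~` B)) t x -> ~ (interior WB) x) ->
        {ae P, forall w, forall K : set 'rV[R]_d, compact K -> forall e : R, 0 < e ->
           exists N : nat, forall n, (N <= n)%N ->
             nbhd_minus WB e `&` K `<=` invscale n (An n w (n%:R * t)) `&` K /\
             invscale n (An n w (n%:R * t)) `&` K `<=` nbhd_plus WB e `&` K})].
Proof.
move=> ppp Hc hu hS hlim htail h0 cB t0 hZ hsz hA0 An WB.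
have Hgood := good_ae hd ppp Hc hu hS hlim htail t0.
have ztZ n w x : isZ (zeta0 n w x) by have [+ _] := hZ n w; apply.
split=> [W0|Wn|Wn hint]; apply: filterS2 Hgood hA0 => w G A0 K cK.
- exact: (coupled_empty G (fun n => ztZ n w) (fun n => hsz n w) cB A0 W0 cK).
- move=> e e0.
  exact: (coupled_boundary G (fun n => ztZ n w) (fun n => hsz n w) cB A0 cK e0).
- move=> e e0.
  exact: (coupled_shape G (fun n => ztZ n w) (fun n => hsz n w) cB A0 cK e0 hint).
Qed.
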